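(* Consider the Set-Family Edge-Cover problem with a disjointness-compliable family $\mathcal{F}$, and suppose Assumptions 1 and 2 hold (with some $\alpha\ge 1$). Then the problem admits a polynomial-time approximation algorithm with approximation ratio $\alpha+\max\{\alpha,2\}\cdot\ln\tau$, where $\tau$ is the number of $\mathcal{F}$-cores.
   Context: Let $G=(V,E)$ be a graph with edge costs $\{c_e: e\in E\}$. An edge $e$ covers a set $A\subset V$ if $e$ has exactly one end in $A$; an edge set $J\subseteq E$ covers $A$ if some $e\in J$ covers $A$, and $J$ covers a set family $\mathcal{F}$ (is an $\mathcal{F}$-cover) if it covers every $A\in\mathcal{F}$. Set-Family Edge-Cover: given $G$, $c$ and a set family $\mathcal{F}$ on $V$ (possibly given implicitly), find a min-cost forest $J\subseteq E$ covering $\mathcal{F}$. A family $\mathcal{F}$ is disjointness-compliable if $A'\subseteq A\in\mathcal{F}$ implies $A'\in\mathcal{F}$ or $A\setminus A'\in\mathcal{F}$. An $\mathcal{F}$-core is an inclusion-minimal member of $\mathcal{F}$. For an $\mathcal{F}$-core $C$, the halo-family $\mathcal{F}(C)$ is the family of all sets in $\mathcal{F}$ that contain no $\mathcal{F}$-core distinct from $C$. An edge set $J$ is a restricted $\mathcal{F}(C)$-cover if $J$ covers $\mathcal{F}(C)$ and no edge of $J$ has an end in an $\mathcal{F}$-core distinct from $C$. For a partial solution $J\subseteq E$, the residual family $\mathcal{F}^J$ consists of the members of $\mathcal{F}$ not covered by $J$; it is regarded as a family on the node set obtained by contracting each connected component of $(V,J)$ into a single node (the residual instance). Assumption 1: for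 any $J\subseteq E$, membership in $\mathcal{F}^J$ can be tested in polynomial time. Assumption 2: for any $J\subseteq E$ and any $\mathcal{F}^J$-core $C$ that has a restricted $\mathcal{F}^J(C)$-cover, one can compute in polynomial time a restricted $\mathcal{F}^J(C)$-cover of cost at most $\alpha$ times the minimum cost of such a cover. *)

(* Defs.v *)
(* MathComp + MathComp-Analysis. *)
From HB Require Import structures.
From mathcomp Require Import all_boot all_order all_algebra.
From mathcomp Require Import all_classical all_reals all_analysis.
Set Implicit Arguments.
Unset Strict Implicit.
Unset Printing Implicit Defensive.
Import Order.TTheory GRing.Theory Num.Theory.
Local Open Scope ring_scope.

(** ** Model of computation

    Polynomial time is understood with respect to a deterministic first-order
    language whose values are binary trees, iterating with [PWhile].  Every
    instruction is charged the size of the tree it reads or copies (there is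
    no sharing of subtrees), so [t] steps can be simulated by a Turing machine
    in time polynomial in [t], and conversely: the polynomial-time programs
    are those of the Turing machine model. *)

Inductive data : Type :=
| Leaf : data
| Node : data -> data -> data.

Fixpoint dsize (x : data) : nat :=
  if x is Node a b then (dsize a + dsize b).+1%N else 1%N.

Inductive prog : Type :=
| PCopy : prog
| PLeaf : prog
| PHead : prog
| PTail : prog
| PPair : prog -> prog -> prog
| PSeq : prog -> prog -> prog
| PIf : prog -> prog -> prog -> prog
| PWhile : prog -> prog -> prog.

(** [run p x t y]: on input [x], the program [p] halts with output [y] after
    time [t].  The test of [PIf] and [PWhile] fails when its value is [Leaf]. *)
Inductive run : prog -> data -> nat -> data -> Prop :=
| run_copy x : run PCopy x (dsize x) x
| run_leaf x : run PLeaf x (dsize x) Leaf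
| run_head_leaf : run PHead Leaf (dsize Leaf) Leaf
| run_head_node a b : run PHead (Node a b) (dsize (Node a b)) a
| run_tail_leaf : run PTail Leaf (dsize Leaf) Leaf
| run_tail_node a b : run PTail (Node a b) (dsize (Node a b)) b
| run_pair p q x t u a b :
    run p x t a -> run q x u b ->
    run (PPair p q) x (dsize x + t + u)%N (Node a b)
| run_seq p q x t u y z :
    run p x t y -> run q y u z -> run (PSeq p q) x (t + u)%N z
| run_if_true b p q x t u c d y :
    run b x t (Node c d) -> run p x u y ->
    run (PIf b p q) x (dsize x + t + u)%N y
| run_if_false b p q x t u y :
    run b x t Leaf -> run q x u y ->
    run (PIf b p q) x (dsize x + t + u)%N y
| run_while_stop b p x t :
    run b x t Leaf -> run (PWhile b p) x (dsize x + t)%N x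
| run_while_step b p x t u v c d y z :
    run b x t (Node c d) -> run p x u y -> run (PWhile b p) y v z ->
    run (PWhile b p) x (dsize x + t + u + v)%N z.

(** The relation is functional: [run] is not a nondeterministic model. *)
Lemma run_functional p x t y u z :
  run p x t y -> run p x u z -> t = u /\ y = z.
Proof.
move=> r; elim: r u z => {p x t y}; intros;
  match goal with H : run _ _ ?u ?z |- _ = ?u /\ _ = ?z => inversion H; subst end;
  repeat match goal with
  | IH : (forall u z, run ?p ?x u z -> _), H : run ?p ?x _ _ |- _ =>
      case: (IH _ _ H) => ? ?; clear H; subst; try discriminate
  end;
  repeat match goal with
  | H : Node _ _ = Node _ _ |- _ => case: H => ? ?; subst
  end; by [].
Qed.

(** Since [1 <= dsize x], each polynomial in [dsize x] with natural
    coefficients is bounded by [k * dsize x ^ k] for some [k]. *)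
Definition computes_within (p : prog) (k : nat) (x y : data) : Prop :=
  exists2 t : nat, run p x t y & (t <= k * dsize x ^ k)%N.

(** ** Encodings *)

Definition enc_seq (s : seq data) : data := foldr Node Leaf s.

Definition enc_bool (b : bool) : data := if b then Node Leaf Leaf else Leaf.

Definition enc_unary (n : nat) : data := enc_seq (nseq n Leaf).

(** Least significant bit first, without leading zeros. *)
Definition bits (n : nat) : seq bool :=
  [seq odd (n %/ 2 ^ i)%N | i <- iota 0 (up_log 2 n.+1)].

Definition enc_binary (n : nat) : data := enc_seq (map enc_bool (bits n)).

(** Meant for nonnegative rationals only: the sign is not recorded. *)
Definition enc_rat (c : rat) : data :=
  Node (enc_binary `|numq c|%N) (enc_binary `|denq c|%N).

Definition enc_set (n : nat) (A : {set 'I_n}) : data :=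
  enc_seq [seq enc_bool (i \in A) | i <- enum 'I_n].

(** ** Instances

    Nodes and edges are numbered; parallel edges and loops are allowed.  The
    tree [desc] is whatever additional input describes the set family
    implicitly. *)
Record instance : Type := Instance {
  nnodes : nat;
  nedges : nat;
  ends : {ffun 'I_nedges -> 'I_nnodes * 'I_nnodes};
  cost : {ffun 'I_nedges -> rat};
  desc : data
}.

Notation node I := ('I_(nnodes I)).
Notation edge I := ('I_(nedges I)).

(** The nodes are written in unary: an [n]-node graph has size at least [n]. *)
Definition enc_instance (I : instance) : data :=
  enc_seq [:: enc_unary (nnodes I);
              enc_seq [seq enc_seq [:: enc_unary (ends I e).1;
                                       enc_unary (ends I e).2;
                                       enc_rat (cost I e)]
                      | e <- enum (edge I)];
              desc I].

(** ** Covers, cores, halo families and residual families *)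

Definition covers_set (I : instance) (e : edge I) (A : {set node I}) : bool :=
  ((ends I e).1 \in A) (+) ((ends I e).2 \in A).

Definition covers (I : instance) (J : {set edge I})
    (F : {set {set node I}}) : bool :=
  [forall A in F, exists e in J, covers_set e A].

Definition disjointness_compliable (T : finType) (F : {set {set T}}) : Prop :=
  forall A A' : {set T}, A' \subset A -> A \in F ->
    (A' \in F) \/ (A :\: A' \in F).

Definition cores (T : finType) (F : {set {set T}}) : {set {set T}} :=
  [set C | minset (fun A => A \in F) C].

Definition halo (T : finType) (F : {set {set T}}) (C : {set T}) :
    {set {set T}} :=
  [set A in F | [forall D in cores F, (D \subset A) ==> (D == C)]].

Definition restricted_cover (I : instance) (F : {set {set node I}})
    (C : {set node I}) (J : {set edge I}) : bool :=
  covers J (halo F C) &&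
  [forall e in J, forall D in cores F,
     (D != C) ==> ((ends I e).1 \notin D) && ((ends I e).2 \notin D)].

(** The members of [F] not covered by [J] are unions of connected components
    of [J].  They are kept as sets of original nodes, rather than as sets of
    contracted nodes; inclusion and covering by edges are the same. *)
Definition residual (I : instance) (F : {set {set node I}})
    (J : {set edge I}) : {set {set node I}} :=
  [set A in F | ~~ [exists e in J, covers_set e A]].

Definition joins (I : instance) (e : edge I) (u v : node I) : bool :=
  (ends I e == (u, v)) || (ends I e == (v, u)).

(** The cycle [u_1, e_1, u_2, e_2, ..., u_k, e_k, u_1] is given by the sequence
    of pairs [(u_i, e_i)]. *)
Definition graph_cycle (I : instance) (s : seq (node I * edge I)) : bool :=
  [&& s != [::], uniq (unzip1 s), uniq (unzip2 s)
    & cycle (fun a b => joins a.2 a.1 b.1) s].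

Definition forest (I : instance) (J : {set edge I}) : Prop :=
  forall s : seq (node I * edge I),
    graph_cycle s -> ~~ all (mem J) (unzip2 s).

Definition feasible (I : instance) (F : {set {set node I}})
    (J : {set edge I}) : Prop :=
  forest J /\ covers J F.

Definition total_cost (I : instance) (J : {set edge I}) : rat :=
  \sum_(e in J) cost I e.

Definition approximate (R : realType) (I : instance)
    (P : {set edge I} -> Prop) (rho : R) (J : {set edge I}) : Prop :=
  P J /\ forall K : {set edge I}, P K ->
    ratr (total_cost J) <= rho * ratr (total_cost K).

(** ** Polynomial-time assumptions and approximation algorithms

    A version of the edge-cover problem is a class [valid] of instances,
    together with the family [F I] that each instance [I] stands for. *)

Definition residual_membership_polytime (valid : instance -> Prop)
    (F : forall I : instance, {set {set node I}}) : Prop :=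
  exists (p : prog) (k : nat), forall I : instance, valid I ->
    forall (J : {set edge I}) (A : {set node I}),
      computes_within p k
        (enc_seq [:: enc_instance I; enc_set J; enc_set A])
        (enc_bool (A \in residual (F I) J)).

(** Nothing is required of the program, not even termination, when the core
    has no restricted cover. *)
Definition restricted_cover_polytime (R : realType) (valid : instance -> Prop)
    (F : forall I : instance, {set {set node I}}) (alpha : R) : Prop :=
  exists (p : prog) (k : nat), forall I : instance, valid I ->
    forall (J : {set edge I}) (C : {set node I}),
      C \in cores (residual (F I) J) ->
      (exists K : {set edge I}, restricted_cover (residual (F I) J) C K) ->
      exists2 K : {set edge I},
        computes_within p k
          (enc_seq [:: enc_instance I; enc_set J; enc_set C]) (enc_set K) &
        approximate (restricted_cover (residual (F I) J) C) alpha K.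

(** The program halts in polynomial time on every instance of the class; its
    output matters only if the instance has a feasible solution. *)
Definition polytime_approximation (R : realType) (valid : instance -> Prop)
    (F : forall I : instance, {set {set node I}})
    (rho : instance -> R) : Prop :=
  exists (p : prog) (k : nat), forall I : instance, valid I ->
    exists2 y : data, computes_within p k (enc_instance I) y &
      (exists K : {set edge I}, feasible (F I) K) ->
      exists2 J : {set edge I}, y = enc_set J &
        approximate (feasible (F I)) (rho I) J.

(* Main.v *)
Require Import Defs.
From HB Require Import structures.
From mathcomp Require Import all_boot all_order all_algebra.
From mathcomp Require Import all_classical all_reals all_analysis.
From mathcomp Require Import zify ring lra.
From mathcomp Require Import fintype finset.
Import Order.TTheory GRing.Theory Num.Theory.
Set Implicit Arguments.
Unset Strict Implicit.
Unset Printing Implicit Defensive.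

(** Splitting a member of a disjointness-compliable family along the connected
    components of [(V, J)] shows that the cores of the residual family are
    exactly the components of [(V, J)] that belong to the family.  The greedy
    algorithm repeatedly adds to [J] a cheapest set among shortest paths from
    one core and the given approximate restricted covers, as long as the set
    merges two cores or destroys one.

    If [K] is a cover and [nu] cores are left, then some candidate costs at most
    [max alpha 2 * c(K) / nu].  Indeed, in a component of [(V, J U K)] with a
    single core the edges of [K] form a restricted cover of that core; in a
    component with several cores the balls around the cores, of radius half the
    least distance between two cores, are disjoint, and [K] crosses each of
    them from the centre to the boundary.  The bound is [alpha * c(K)] when
    [nu = 1].  Since [1/nu <= ln nu - ln (nu - 1)], the sum of the current cost
    and of [c(K) * (alpha + max alpha 2 * ln nu)] never increases.  Finally,
    edges on cycles are deleted.

    The algorithm is polynomial because polynomial-time functions are closed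
    under composition, branching and folds whose accumulators stay polynomially
    bounded. *)

(** Three obstacles shape the algorithm. The family is visible only through membership queries for
    residual families, so every test has to reduce to queries about components. The program of
    assumption 2 may diverge on a core without restricted cover, so each call is guarded by
    [coverable]: all restricted covers of a core lie in the set of edges that avoid the other cores,
    and one exists exactly if adding this whole set makes the core disappear. Finally, the program
    has to halt on infeasible instances too. A family containing [set0] has no cover, and [core] is
    false everywhere for it, so that nothing is done.

    The constant 2 is the price of a path: if [r] is half the least distance between two cores, the
    packing shows that [K] pays [r] per core, while the path between a closest pair costs [2 r]. A
    path needs two cores, so the last core costs only [alpha * c(K)]. This is why [alpha] stands
    outside the logarithm, whose factor collects the rounds with at least two cores. *)

Local Open Scope nat_scope.

(** * Polynomial-time programs *)

Lemma dsize_gt0 x : 0 < dsize x. Proof. by case: x. Qed.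

(** Every instruction is charged for what it reads, so a time bound is also a bound on the output
    size. This keeps compositions polynomial. *)
Lemma run_dsize p x t y : run p x t y -> dsize y <= t.
Proof.
elim=> {p x t y} //=; try by [move=> *; lia | exact: dsize_gt0].
by move=> p q x t u a b _ ? _ ?; have := dsize_gt0 x; lia.
Qed.

Section Bounded.
Variables (X : Type) (i : X -> data).

Definition bounded (g : X -> nat) := exists k, forall x, g x <= k * dsize (i x) ^ k.

Lemma bounded_le g h : (forall x, g x <= h x) -> bounded h -> bounded g.
Proof. by move=> gh [k Hk]; exists k => x; apply: leq_trans (gh x) (Hk x). Qed.

Lemma bounded_const c : bounded (fun=> c).
Proof. by exists c => x; rewrite leq_pmulr // expn_gt0 dsize_gt0. Qed.

Lemma bounded_dsize : bounded (fun x => dsize (i x)).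
Proof. by exists 1 => x; rewrite mul1n expn1. Qed.

Lemma bounded_add g h : bounded g -> bounded h -> bounded (fun x => g x + h x).
Proof.
move=> [k Hk] [l Hl]; exists (k + l) => x.
rewrite mulnDl leq_add //.
  by apply: leq_trans (Hk x) _; rewrite leq_mul // leq_pexp2l ?dsize_gt0 ?leq_addr.
by apply: leq_trans (Hl x) _; rewrite leq_mul // leq_pexp2l ?dsize_gt0 ?leq_addl.
Qed.

Lemma bounded_mul g h : bounded g -> bounded h -> bounded (fun x => g x * h x).
Proof.
move=> [k Hk] [l Hl]; exists (k * l + k + l) => x.
apply: leq_trans (leq_mul (Hk x) (Hl x)) _.
rewrite mulnACA -expnD leq_mul //; first by lia.
by rewrite leq_pexp2l ?dsize_gt0 //; lia.
Qed.

Lemma bounded_exp g c : bounded g -> bounded (fun x => g x ^ c).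
Proof.
move=> bg; elim: c => [|c IH]; first exact: bounded_const.
by apply: bounded_le (bounded_mul bg IH) => x; rewrite expnS.
Qed.

End Bounded.

Lemma bounded_comp X (i j : X -> data) g :
  bounded i (fun x => dsize (j x)) -> bounded j g -> bounded i g.
Proof.
move=> bj [k Hk]; apply: bounded_le Hk _.
by apply: bounded_mul; [exact: bounded_const | exact: bounded_exp].
Qed.

(* A context [x : X] bundles free variables with the hypotheses about them, and
   [i x] is its encoding. *)
Definition fp (X : Type) (i f : X -> data) : Prop :=
  exists p k, forall x, computes_within p k (i x) (f x).

Section Fp.
Variable X : Type.
Implicit Types i f g : X -> data.

Lemma fp_bound i f : fp i f -> bounded i (fun x => dsize (f x)).
Proof.
move=> [p [k H]]; exists k => x; have [t r le_t] := H x.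
exact: leq_trans (run_dsize r) le_t.
Qed.

Lemma fpI i f p (g : X -> nat) : bounded i g ->
  (forall x, exists2 t, run p (i x) t (f x) & t <= g x) -> fp i f.
Proof.
move=> [k Hk] H; exists p, k => x; have [t r le_t] := H x.
by exists t => //; apply: leq_trans le_t (Hk x).
Qed.

Lemma fp_eq i f g : fp i f -> f =1 g -> fp i g.
Proof. by move=> [p [k H]] e; exists p, k => x; rewrite -e. Qed.

Lemma fp_id i : fp i i.
Proof.
apply: (@fpI _ _ PCopy (fun x => dsize (i x))); first exact: bounded_dsize.
by move=> x; exists (dsize (i x)) => //; constructor.
Qed.

Lemma fp_leaf i : fp i (fun=> Leaf).
Proof.
apply: (@fpI _ _ PLeaf (fun x => dsize (i x))); first exact: bounded_dsize.
by move=> x; exists (dsize (i x)) => //; constructor.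
Qed.

Lemma fp_comp i f g : fp i f -> fp f g -> fp i g.
Proof.
move=> fpf [q [l Hq]]; have bf := fp_bound fpf.
have bq : bounded i (fun x => l * dsize (f x) ^ l).
  by apply: bounded_mul; [exact: bounded_const | exact: bounded_exp].
case: fpf => p [k Hp].
apply: (@fpI _ _ (PSeq p q) (fun x => k * dsize (i x) ^ k + l * dsize (f x) ^ l)).
  by apply: bounded_add => //; exists k.
move=> x; have [t rt lt] := Hp x; have [u ru lu] := Hq x.
by exists (t + u); [exact: run_seq rt ru | exact: leq_add].
Qed.

Lemma fp_pair i f g : fp i f -> fp i g -> fp i (fun x => Node (f x) (g x)).
Proof.
move=> [p [k Hp]] [q [l Hq]].
apply: (@fpI _ _ (PPair p q)
  (fun x => dsize (i x) + k * dsize (i x) ^ k + l * dsize (i x) ^ l)).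
  by do 2?apply: bounded_add; [exact: bounded_dsize | exists k | exists l].
move=> x; have [t rt lt] := Hp x; have [u ru lu] := Hq x.
by exists (dsize (i x) + t + u); [exact: run_pair | rewrite !leq_add].
Qed.

Definition dhead d := if d is Node a _ then a else Leaf.
Definition dtail d := if d is Node _ b then b else Leaf.

Lemma fp_head i f : fp i f -> fp i (fun x => dhead (f x)).
Proof.
move=> H; apply: fp_comp H _.
apply: (@fpI _ _ PHead (fun x => dsize (f x))); first exact: bounded_dsize.
by move=> x; exists (dsize (f x)) => //; case: (f x) => [|a b]; constructor.
Qed.

Lemma fp_tail i f : fp i f -> fp i (fun x => dtail (f x)).
Proof.
move=> H; apply: fp_comp H _.
apply: (@fpI _ _ PTail (fun x => dsize (f x))); first exact: bounded_dsize.
by move=> x; exists (dsize (f x)) => //; case: (f x) => [|a b]; constructor.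
Qed.

Lemma fp_case i b f g : fp i b -> fp i f -> fp i g ->
  fp i (fun x => if b x is Node _ _ then f x else g x).
Proof.
move=> [c [m Hc]] [p [k Hp]] [q [l Hq]].
apply: (@fpI _ _ (PIf c p q)
  (fun x => dsize (i x) + m * dsize (i x) ^ m +
            (k * dsize (i x) ^ k + l * dsize (i x) ^ l))).
  by do 3?apply: bounded_add; [exact: bounded_dsize | exists m | exists k | exists l].
move=> x; have [t rt lt] := Hp x; have [u ru lu] := Hq x; have [v rv lv] := Hc x.
case: (b x) rv => [|a d] rv.
  exists (dsize (i x) + v + u); first exact: run_if_false rv ru.
  by rewrite leq_add ?leq_add // (leq_trans lu) // leq_addl.
exists (dsize (i x) + v + t); first exact: run_if_true rv rt.
by rewrite leq_add ?leq_add // (leq_trans lt) // leq_addr.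
Qed.

End Fp.

(* A branch need only be computable in the contexts that reach it. *)
Lemma fp_if_dep X (i : X -> data) (b : X -> bool) f g :
  fp i (fun x => enc_bool (b x)) ->
  fp (fun z : {x | b x} => i (sval z)) (fun z => f (sval z)) ->
  fp i g ->
  fp i (fun x => if b x then f x else g x).
Proof.
move=> [c [m Hc]] [p [k Hp]] [q [l Hq]].
apply: (@fpI _ _ _ (PIf c p q)
  (fun x => dsize (i x) + m * dsize (i x) ^ m +
            (k * dsize (i x) ^ k + l * dsize (i x) ^ l))).
  by do 3?apply: bounded_add; [exact: bounded_dsize | exists m | exists k | exists l].
move=> x; have [u ru lu] := Hq x; have [v rv lv] := Hc x.
case bx: (b x) rv => rv.
  have [t rt lt] := Hp (exist _ x bx).
  exists (dsize (i x) + v + t); first exact: run_if_true rv rt.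
  by rewrite leq_add ?leq_add // (leq_trans lt) // leq_addr.
exists (dsize (i x) + v + u); first exact: run_if_false rv ru.
by rewrite leq_add ?leq_add // (leq_trans lu) // leq_addl.
Qed.

Lemma fp_reindex X Y (h : Y -> X) i f :
  fp i f -> fp (fun y => i (h y)) (fun y => f (h y)).
Proof. by move=> [p [k H]]; exists p, k => y. Qed.

Lemma fp_if X (i : X -> data) (b : X -> bool) f g :
  fp i (fun x => enc_bool (b x)) -> fp i f -> fp i g ->
  fp i (fun x => if b x then f x else g x).
Proof. by move=> Hb Hf Hg; apply: fp_if_dep => //; apply: fp_reindex. Qed.

Lemma leq_exp m n e : m <= n -> m ^ e <= n ^ e.
Proof. by case: e => [|e] mn; rewrite ?expn0 ?leq_exp2r. Qed.

(** * Loops, folds and programs on lists *)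

Section While.
Variables (S : Type) (s2d : S -> data) (c : S -> bool) (next : S -> S).
Variables (g b : prog) (kg kb : nat).
Hypothesis guardP : forall s, computes_within g kg (s2d s) (enc_bool (c s)).
Hypothesis bodyP : forall s, c s -> computes_within b kb (s2d s) (s2d (next s)).

(** [M] bounds every state that is met, so the factor in parentheses bounds one round. The guard is
    evaluated once more than the body, hence [N.+1]. *)
Lemma run_while N M s :
  (forall j, j < N -> c (iter j next s)) -> ~~ c (iter N next s) ->
  (forall j, j <= N -> dsize (s2d (iter j next s)) <= M) ->
  exists2 t, run (PWhile g b) (s2d s) t (s2d (iter N next s)) &
    t <= N.+1 * (M + kg * M ^ kg + kb * M ^ kb).
Proof.
elim: N s => [|N IH] s cN nc szM.
  have [t rt lt] := guardP s; rewrite /= in nc *; rewrite (negbTE nc) in rt.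
  exists (dsize (s2d s) + t); first exact: run_while_stop.
  have /= le0 := szM 0 isT; rewrite mul1n -addnA leq_add //.
  rewrite (leq_trans lt) // (leq_trans _ (leq_addr _ _)) //.
  by rewrite leq_mul // leq_exp.
have cs : c s by exact: (cN 0).
have [t rt lt] := guardP s; rewrite cs in rt.
have [u ru lu] := bodyP cs.
have [||j jN|v rv lv] := IH (next s).
- by move=> j jN; rewrite -iterSr; exact: cN.
- by rewrite -iterSr.
- by rewrite -iterSr; exact: szM.
exists (dsize (s2d s) + t + u + v).
  by rewrite iterSr; exact: run_while_step rt ru rv.
rewrite mulSn leq_add //.
have /= le0 := szM 0 isT.
rewrite !leq_add // ?(leq_trans lt) ?(leq_trans lu) //.
  by rewrite leq_mul // leq_exp.
by rewrite leq_mul // leq_exp.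
Qed.

End While.

Section Fold.
Variables (X : Type) (A B : X -> Type) (i : X -> data).
Variables (ea : forall x, A x -> data) (eb : forall x, B x -> data).

(** The environment of a loop body: context, current element, accumulator. It is a dependent sum
    because node and edge types vary with the instance. *)
Definition ext2 (z : {x : X & (A x * B x)%type}) : data :=
  Node (i (tag z)) (Node (ea (tagged z).1) (eb (tagged z).2)).

Lemma fp_env2 f : fp i f -> fp ext2 (fun z => f (tag z)).
Proof.
move=> H; apply: (@fp_comp _ _ (fun z => i (tag z))).
  exact: fp_eq (fp_head (fp_id _)) _.
exact: (fp_reindex (fun z : {x : X & (A x * B x)%type} => tag z) H).
Qed.

Lemma fp_elt : fp ext2 (fun z => ea (tagged z).1).
Proof. exact: fp_eq (fp_head (fp_tail (fp_id _))) _. Qed.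

Lemma fp_acc : fp ext2 (fun z => eb (tagged z).2).
Proof. exact: fp_eq (fp_tail (fp_tail (fp_id _))) _. Qed.

Variable step : forall x, B x -> A x -> B x.
Hypothesis fp_step :
  fp ext2 (fun z => eb (step (tagged z).2 (tagged z).1)).

Let S := {x : X & (seq (A x) * B x)%type}.

Let s2d (s : S) : data :=
  Node (i (tag s)) (Node (enc_seq (map (@ea _) (tagged s).1)) (eb (tagged s).2)).

Let next (s : S) : S :=
  let: existT x (l, b) := s in
  if l is a :: l' then existT _ x (l', step b a) else s.

Let more (s : S) : bool := if (tagged s).1 is [::] then false else true.

Let iter_next x l b j : j <= size l ->
  iter j next (existT _ x (l, b)) =
  existT _ x (drop j l, foldl (@step x) b (take j l)).
Proof.
elim: j l b => [|j IH] l b; first by rewrite drop0 take0.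
by case: l => //= a l ltj; rewrite -iterS iterSr /= IH.
Qed.

Let more_fp : fp s2d (fun s => enc_bool (more s)).
Proof.
apply: fp_eq (fp_case (fp_head (fp_tail (fp_id _)))
  (fp_pair (fp_leaf _) (fp_leaf _)) (fp_leaf _)) _.
by move=> [x [[|a l] b]].
Qed.

Let body_fp : exists p k, forall s, more s ->
  computes_within p k (s2d s) (s2d (next s)).
Proof.
pose Y := {x : X & ((A x * seq (A x)) * B x)%type}.
pose iy (y : Y) : data := s2d
  (existT _ (tag y) ((tagged y).1.1 :: (tagged y).1.2, (tagged y).2)).
have [p [k H]] : fp iy (fun y => s2d (existT _ (tag y)
    ((tagged y).1.2, step (tagged y).2 (tagged y).1.1))).
  apply: fp_pair; first exact: fp_eq (fp_head (fp_id _)) _.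
  apply: fp_pair; first exact: fp_eq (fp_tail (fp_head (fp_tail (fp_id _)))) _.
  pose h (y : Y) : {x : X & (A x * B x)%type} :=
    existT _ (tag y) ((tagged y).1.1, (tagged y).2).
  apply: fp_comp (fp_reindex h fp_step).
  apply: fp_pair; first exact: fp_eq (fp_head (fp_id _)) _.
  apply: fp_pair; first exact: fp_eq (fp_head (fp_head (fp_tail (fp_id _)))) _.
  exact: fp_eq (fp_tail (fp_tail (fp_id _))) _.
exists p, k => -[x [[|a l] b]] //= _.
exact: (H (existT _ x ((a, l), b))).
Qed.

Variables (l : forall x, seq (A x)) (b0 : forall x, B x).

Lemma size_enc_seq (s : seq data) : size s < dsize (enc_seq s).
Proof. by elim: s => //= d s; lia. Qed.

(** The last hypothesis excludes growth by iteration: a polynomial step that doubles its accumulator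
    would reach exponential size. *)
Lemma fp_foldl :
  fp i (fun x => enc_seq (map (@ea x) (l x))) ->
  fp i (fun x => eb (b0 x)) ->
  (exists2 g, bounded i g & forall x l1 l2, l x = l1 ++ l2 ->
     dsize (eb (foldl (@step x) (b0 x) l1)) <= g x) ->
  fp i (fun x => eb (foldl (@step x) (b0 x) (l x))).
Proof.
move=> fpl fpb [g bg Hg].
pose ini x : S := existT _ x (l x, b0 x).
have fpi : fp i (fun x => s2d (ini x)).
  by apply: fp_pair; [exact: fp_id | exact: fp_pair].
suff fpw : fp (fun x => s2d (ini x)) (fun x => s2d (iter (size (l x)) next (ini x))).
  have := fp_tail (fp_tail (fp_comp fpi fpw)).
  by move/fp_eq; apply => x; rewrite iter_next //= take_size.
have [gp [kg gP]] := more_fp; have [bp [kb bP]] := body_fp.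
have bi : bounded (fun x => s2d (ini x)) (fun x => dsize (i x)).
  apply: bounded_le (bounded_dsize _) => x /=; lia.
have bl : bounded (fun x => s2d (ini x)) (fun x => dsize (enc_seq (map (@ea x) (l x)))).
  apply: bounded_le (bounded_dsize _) => x /=; lia.
have bg' := bounded_comp bi bg.
(* A state consists of three encodings under two [Node]s. *)
pose M x := 2 + dsize (i x) + dsize (enc_seq (map (@ea x) (l x))) + g x.
have bM : bounded (fun x => s2d (ini x)) M.
  by do !apply: bounded_add => //; exact: bounded_const.
apply: (@fpI _ _ _ (PWhile gp bp) (fun x =>
  (dsize (enc_seq (map (@ea x) (l x)))) * (M x + kg * M x ^ kg + kb * M x ^ kb))).
  apply: bounded_mul => //; do !apply: bounded_add => //.
    by apply: bounded_mul; [exact: bounded_const | exact: bounded_exp].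
  by apply: bounded_mul; [exact: bounded_const | exact: bounded_exp].
move=> x.
have [||j jN|t rt lt] := run_while gP bP (N := size (l x)) (M := M x) (s := ini x).
- move=> j jN; rewrite iter_next /more /= 1?ltnW //.
  by case E: (drop j (l x)) => //; move/(congr1 size): E; rewrite size_drop /=; lia.
- by rewrite iter_next // /more /= drop_size.
- rewrite iter_next //= /M.
  have := Hg x (take j (l x)) (drop j (l x)); rewrite cat_take_drop => /(_ erefl).
  suff : dsize (enc_seq (map (@ea x) (drop j (l x)))) <=
         dsize (enc_seq (map (@ea x) (l x))) by lia.
  by elim: (l x) j {jN} => [|a s IH] [|j] //=; have := IH j; lia.
exists t => //; apply: leq_trans lt _; rewrite leq_mul //.
by have := size_enc_seq (map (@ea x) (l x)); rewrite size_map.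
Qed.

End Fold.
Arguments ext2 {X A B} i ea eb z /.

Lemma fp_true X (i : X -> data) : fp i (fun=> enc_bool true).
Proof. by apply: fp_pair; exact: fp_leaf. Qed.

Lemma fp_false X (i : X -> data) : fp i (fun=> enc_bool false).
Proof. exact: fp_leaf. Qed.

Lemma fp_neg X (i : X -> data) b :
  fp i (fun x => enc_bool (b x)) -> fp i (fun x => enc_bool (~~ b x)).
Proof.
move=> H; apply: fp_eq (fp_if H (fp_false _) (fp_true _)) _ => x.
by case: (b x).
Qed.

Lemma fp_and X (i : X -> data) b c :
  fp i (fun x => enc_bool (b x)) -> fp i (fun x => enc_bool (c x)) ->
  fp i (fun x => enc_bool (b x && c x)).
Proof.
move=> Hb Hc; apply: fp_eq (fp_if Hb Hc (fp_false _)) _ => x.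
by case: (b x).
Qed.

Lemma fp_or X (i : X -> data) b c :
  fp i (fun x => enc_bool (b x)) -> fp i (fun x => enc_bool (c x)) ->
  fp i (fun x => enc_bool (b x || c x)).
Proof.
move=> Hb Hc; apply: fp_eq (fp_if Hb (fp_true _) Hc) _ => x.
by case: (b x).
Qed.

Lemma fp_eqb X (i : X -> data) b c :
  fp i (fun x => enc_bool (b x)) -> fp i (fun x => enc_bool (c x)) ->
  fp i (fun x => enc_bool (b x == c x)).
Proof.
move=> Hb Hc; apply: fp_eq (fp_if Hb Hc (fp_neg Hc)) _ => x.
by case: (b x); case: (c x).
Qed.

Lemma dsize_enc_seq s : dsize (enc_seq s) = (sumn [seq (dsize d).+1 | d <- s]).+1.
Proof. by elim: s => //= d s ->; rewrite addnS. Qed.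

Lemma dsize_enc_unary n : dsize (enc_unary n) = n.*2.+1.
Proof. by elim: n => //= n; rewrite /enc_unary => ->; rewrite doubleS. Qed.

Lemma dsize_enc_bool b : dsize (enc_bool b) <= 3.
Proof. by case: b. Qed.

Lemma dsize_map_le (T : Type) (f : T -> data) (s : seq T) m :
  (forall a, List.In a s -> dsize (f a) <= m) ->
  dsize (enc_seq (map f s)) <= (size s * m.+1).+1.
Proof.
rewrite dsize_enc_seq ltnS; elim: s => //= a s IH H.
by rewrite mulSn leq_add //; [rewrite ltnS; apply: H; left | apply: IH; auto].
Qed.

Lemma dsize_enc_set n (A : {set 'I_n}) : dsize (enc_set A) <= (n * 4).+1.
Proof.
apply: leq_trans (dsize_map_le (fun a _ => dsize_enc_bool (a \in A))) _.
by rewrite size_enum_ord.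
Qed.

Section Map.
Variables (X : Type) (A : X -> Type) (i : X -> data) (ea : forall x, A x -> data).

Definition ext1 (z : {x : X & A x}) : data := Node (i (tag z)) (ea (tagged z)).

Lemma fp_env1 f : fp i f -> fp ext1 (fun z => f (tag z)).
Proof.
move=> H; apply: (@fp_comp _ _ (fun z => i (tag z))).
  exact: fp_eq (fp_head (fp_id _)) _.
exact: (fp_reindex (fun z : {x : X & A x} => tag z) H).
Qed.

Lemma fp_var : fp ext1 (fun z => ea (tagged z)).
Proof. exact: fp_eq (fp_tail (fp_id _)) _. Qed.

(** Substitution: [h] supplies the value of the bound variable. *)
Lemma fp_call Y (j : Y -> data) (h : Y -> {x : X & A x}) f :
  fp ext1 f -> fp j (fun y => i (tag (h y))) -> fp j (fun y => ea (tagged (h y))) ->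
  fp j (fun y => f (h y)).
Proof. by move=> H Hi Ha; apply: fp_comp (fp_reindex h H); exact: fp_pair. Qed.

End Map.

(** A fold that conses its results returns them reversed; [fp_map] restores the order with this
    lemma. *)
Lemma fp_rev X (i : X -> data) (s : X -> seq data) :
  fp i (fun x => enc_seq (s x)) -> fp i (fun x => enc_seq (rev (s x))).
Proof.
move=> H.
have E l (b : seq data) : foldl (fun b a => a :: b) b l = catrev l b.
  by elim: l b => //= a l IH b; rewrite IH.
suff: fp i (fun x => enc_seq (foldl (fun b a => a :: b) [::] (s x))).
  by move/fp_eq; apply => x; rewrite E.
pose id' (x : X) (d : data) := d; pose enc' (x : X) (t : seq data) := enc_seq t.
apply: (@fp_foldl X (fun=> data) (fun=> seq data) i id' enc'
  (fun x b a => a :: b) _ s (fun=> [::])).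
- apply: fp_pair; [exact: fp_elt | exact: fp_acc].
- by apply: fp_eq H _ => x; rewrite map_id.
- exact: fp_leaf.
exists (fun x => dsize (enc_seq (s x))); first exact: fp_bound.
move=> x l1 l2 ->; rewrite E /enc' -/(rev l1) !dsize_enc_seq map_rev sumn_rev.
by rewrite map_cat sumn_cat; lia.
Qed.

Lemma fp_map X (A : X -> Type) (i : X -> data) (ea : forall x, A x -> data)
    (l : forall x, seq (A x)) (f : forall x, A x -> data) :
  fp i (fun x => enc_seq [seq ea x a | a <- l x]) ->
  fp (ext1 i ea) (fun z => f (tag z) (tagged z)) ->
  fp i (fun x => enc_seq [seq f x a | a <- l x]).
Proof.
move=> Hl Hf.
have E x l' (b : seq data) :
    foldl (fun b a => f x a :: b) b l' = catrev (map (f x) l') b.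
  by elim: l' b => //= a l' IH b; rewrite IH.
suff: fp i (fun x => enc_seq (foldl (fun b a => f x a :: b) [::] (l x))).
  by move/fp_rev/fp_eq; apply => x; rewrite E -/(rev _) revK.
pose enc' (x : X) (t : seq data) := enc_seq t.
apply: (@fp_foldl X A (fun=> seq data) i ea enc'
  (fun x b a => f x a :: b) _ l (fun=> [::])) => //.
- apply: fp_pair; last exact: fp_acc.
  pose h (z : {x : X & (A x * seq data)%type}) : {x : X & A x} :=
    existT _ (tag z) (tagged z).1.
  apply: (fp_call (h := h) Hf); last exact: fp_elt.
  exact: (@fp_env2 _ _ _ _ _ enc' _ (fp_id i)).
- exact: fp_leaf.
have [k Hk] := fp_bound Hf.
pose d x := dsize (enc_seq [seq ea x a | a <- l x]).
have bd : bounded i d := fp_bound Hl.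
exists (fun x => d x * (k * (1 + dsize (i x) + d x) ^ k + 1) + 1).
  apply: bounded_add; last exact: bounded_const.
  apply: bounded_mul => //; apply: bounded_add; last exact: bounded_const.
  apply: bounded_mul; first exact: bounded_const.
  apply/bounded_exp; do !apply: bounded_add => //; first exact: bounded_const.
  exact: bounded_dsize.
move=> x l1 l2 El; rewrite E -/(rev _) /enc'.
have -> : dsize (enc_seq (rev [seq f x a | a <- l1])) =
          dsize (enc_seq [seq f x a | a <- l1]).
  by rewrite !dsize_enc_seq map_rev sumn_rev.
have Hm a : List.In a l1 -> dsize (f x a) <= k * (1 + dsize (i x) + d x) ^ k.
  move=> Ha; apply: leq_trans (Hk (existT _ x a)) _; rewrite leq_mul // leq_exp //= add1n ltnS.
  rewrite leq_add2l /d El {El Hl bd d}.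
  by elim: l1 Ha => //= b l1 IH [->|/IH]; lia.
apply: leq_trans (dsize_map_le Hm) _.
rewrite -addn1 leq_add2r addn1 leq_mul // /d; apply: leq_trans (ltnW (size_enc_seq _)).
by rewrite size_map El size_cat leq_addr.
Qed.

Lemma fp_has X (A : X -> Type) (i : X -> data) (ea : forall x, A x -> data)
    (l : forall x, seq (A x)) (P : forall x, A x -> bool) :
  fp i (fun x => enc_seq [seq ea x a | a <- l x]) ->
  fp (ext1 i ea) (fun z => enc_bool (P (tag z) (tagged z))) ->
  fp i (fun x => enc_bool (has (P x) (l x))).
Proof.
move=> Hl HP.
have E x l' b : foldl (fun b a => b || P x a) b l' = b || has (P x) l'.
  by elim: l' b => [|a l' IH] b /=; rewrite ?orbF // IH orbA.
suff: fp i (fun x => enc_bool (foldl (fun b a => b || P x a) false (l x))).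
  by move/fp_eq; apply => x; rewrite E.
pose enc' (x : X) b := enc_bool b.
apply: (@fp_foldl X A (fun=> bool) i ea enc'
  (fun x b a => b || P x a) _ l (fun=> false)) => //.
- apply: fp_or; first exact: fp_acc.
  pose h (z : {x : X & (A x * bool)%type}) : {x : X & A x} :=
    existT _ (tag z) (tagged z).1.
  apply: (fp_call (h := h) HP); last exact: fp_elt.
  exact: (@fp_env2 _ _ _ _ _ enc' _ (fp_id i)).
- exact: fp_false.
by exists (fun=> 3) => [|x l1 l2 _]; [exact: bounded_const | exact: dsize_enc_bool].
Qed.

Section Iter.
Variables (X : Type) (B : X -> Type) (i : X -> data) (eb : forall x, B x -> data).
Variables (f : forall x, B x -> B x) (n : X -> nat) (b0 : forall x, B x).

(** A unary number is encoded as a list of leaves, so the iteration is a fold over that list which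
    ignores the elements. *)
Lemma fp_iter :
  fp i (fun x => enc_unary (n x)) -> fp i (fun x => eb (b0 x)) ->
  fp (ext1 i eb) (fun z => eb (f (tagged z))) ->
  (exists2 g, bounded i g & forall x j, j <= n x ->
     dsize (eb (iter j (@f x) (b0 x))) <= g x) ->
  fp i (fun x => eb (iter (n x) (@f x) (b0 x))).
Proof.
move=> Hn Hb Hf [g bg Hg].
have E x l (b : B x) : foldl (fun b (_ : data) => f b) b l = iter (size l) (@f x) b.
  by elim: l b => //= a l IH b; rewrite IH -iterSr.
suff: fp i (fun x => eb (foldl (fun b (_ : data) => f b) (b0 x) (nseq (n x) Leaf))).
  by move/fp_eq; apply => x; rewrite E size_nseq.
pose id' (x : X) (d : data) := d.
apply: (@fp_foldl X (fun=> data) B i id' eb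
  (fun x b _ => f b) _ (fun x => nseq (n x) Leaf) b0) => //.
- pose h (z : {x : X & (data * B x)%type}) : {x : X & B x} :=
    existT _ (tag z) (tagged z).2.
  apply: (fp_call (h := h) Hf); last exact: fp_acc.
  exact: (@fp_env2 _ _ _ _ id' eb _ (fp_id i)).
- by apply: fp_eq Hn _ => x; rewrite map_id.
exists g => // x l1 l2 El; rewrite E; apply: Hg.
by move/(congr1 size): El; rewrite size_cat size_nseq => ->; rewrite leq_addr.
Qed.

End Iter.

Lemma fp_drop X (i : X -> data) (s : X -> seq data) k :
  fp i (fun x => enc_unary (k x)) -> fp i (fun x => enc_seq (s x)) ->
  fp i (fun x => enc_seq (drop (k x) (s x))).
Proof.
move=> Hk Hs; pose enc' (x : X) (t : seq data) := enc_seq t.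
have E (l : seq data) j : iter j behead l = drop j l.
  by elim: j l => [|j IH] [|a l] //; rewrite iterSr //= IH ?drop0.
suff: fp i (fun x => enc_seq (iter (k x) behead (s x))).
  by move/fp_eq; apply => x; rewrite E.
apply: (@fp_iter X (fun=> seq data) i enc' (fun=> behead)) => //.
  apply: fp_eq (fp_tail (@fp_var _ _ _ enc')) _.
  by move=> [x [|a l]].
exists (fun x => dsize (enc_seq (s x))) => [|x j _]; first exact: fp_bound.
by rewrite E /enc'; elim: j (s x) => [|j IH] [|a l] //=; have := IH l; lia.
Qed.

Lemma fp_nth X (i : X -> data) (s : X -> seq data) k :
  fp i (fun x => enc_unary (k x)) -> fp i (fun x => enc_seq (s x)) ->
  fp i (fun x => nth Leaf (s x) (k x)).
Proof.
move=> Hk Hs; apply: fp_eq (fp_head (fp_drop Hk Hs)) _ => x.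
by elim: (k x) (s x) => [|j IH] [|a l] //=.
Qed.

Lemma fp_subn X (i : X -> data) a b :
  fp i (fun x => enc_unary (a x)) -> fp i (fun x => enc_unary (b x)) ->
  fp i (fun x => enc_unary (a x - b x)).
Proof.
move=> Ha Hb; apply: fp_eq (fp_drop Hb Ha) _ => x.
by rewrite /enc_unary drop_nseq.
Qed.

Lemma fp_eqn X (i : X -> data) a b :
  fp i (fun x => enc_unary (a x)) -> fp i (fun x => enc_unary (b x)) ->
  fp i (fun x => enc_bool (a x == b x)).
Proof.
move=> Ha Hb; apply: fp_eq (fp_case (fp_subn Ha Hb) (fp_false _)
  (fp_case (fp_subn Hb Ha) (fp_false _) (fp_true _))) _ => x.
by rewrite eqn_leq /leq; case: (a x - b x) => [|k] //; case: (b x - a x).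
Qed.

Lemma In_mem (T : eqType) (a : T) s : List.In a s -> a \in s.
Proof. by elim: s => //= b s IH [->|/IH]; rewrite inE ?eqxx // => ->; rewrite orbT. Qed.

(** * Programs on ordinals, sets and instances *)

Section Ordinals.
Variables (X : Type) (i : X -> data) (n : X -> nat).
Hypothesis Hn : fp i (fun x => enc_unary (n x)).

Lemma bounded_unary : bounded i n.
Proof. by apply: bounded_le (fp_bound Hn) => x; rewrite dsize_enc_unary; lia. Qed.

Lemma fp_enum : fp i (fun x => enc_seq [seq enc_unary (v : 'I_(n x)) | v <- enum 'I_(n x)]).
Proof.
pose B (x : X) := (nat * seq nat)%type.
pose eb (x : X) (b : B x) := Node (enc_unary b.1) (enc_seq (map enc_unary b.2)).
(* Counting down makes consing produce the increasing enumeration. *)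
pose f (x : X) (b : B x) : B x := (b.1.-1, b.1.-1 :: b.2).
have E x j : j <= n x -> iter j (@f x) (n x, [::]) = (n x - j, iota (n x - j) j).
  elim: j => [|j IH] jn; first by rewrite subn0.
  rewrite iterS IH 1?ltnW // /f /=; congr pair; first by lia.
  by rewrite -subnS; congr cons; congr iota; lia.
suff H : fp i (fun x => eb x (iter (n x) (@f x) (n x, [::]))).
  apply: fp_eq (fp_tail H) _ => x; rewrite E // subnn /= -val_enum_ord -map_comp.
  by congr enc_seq; apply: eq_map.
apply: (@fp_iter X B i eb f n (fun x => (n x, [::]))) => //.
- by apply: fp_pair => //; exact: fp_leaf.
- have H : fp (ext1 i eb) (fun z => enc_unary (tagged z).1.-1).
    apply: fp_eq (fp_tail (fp_head (fp_tail (fp_id _)))) _.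
    by move=> [x [[|a] b]].
  apply: fp_pair => //; apply: fp_pair => //.
  exact: fp_eq (fp_tail (fp_tail (fp_id _))) _.
exists (fun x => 3 + n x * 2 + n x * (2 + n x * 2)).
  have bn := bounded_unary.
  by do ?[apply: bounded_const | apply: bn | apply: bounded_add | apply: bounded_mul].
move=> x j jn; rewrite E //= dsize_enc_unary.
have Hm a : List.In a (iota (n x - j) j) -> dsize (enc_unary a) <= (n x).*2.+1.
  by move/In_mem; rewrite mem_iota dsize_enc_unary; lia.
by have := dsize_map_le Hm; rewrite size_iota; nia.
Qed.

End Ordinals.

(* Moves the hypotheses about the outer context to the extended one, and forgets
   how the latter is encoded. *)
Ltac fp_enter := cbv beta;
  lazymatch goal with
  | |- fp (@ext1 ?X ?A ?i ?ea) _ =>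
    let V := fresh "V" in
    have V := @fp_var X A i ea; cbv beta in V;
    repeat match goal with
    | H : fp i _ |- _ => let W := fresh "W" in
        have W := @fp_env1 X A i ea _ H; cbv beta in W; clear H
    end;
    let j := fresh "j" in let E := fresh "E" in
    remember (@ext1 X A i ea) as j eqn:E; clear E
  | |- fp (@ext2 ?X ?A ?B ?i ?ea ?eb) _ =>
    let V := fresh "V" in let U := fresh "U" in
    have V := @fp_elt X A B i ea eb; cbv beta in V;
    have U := @fp_acc X A B i ea eb; cbv beta in U;
    repeat match goal with
    | H : fp i _ |- _ => let W := fresh "W" in
        have W := @fp_env2 X A B i ea eb _ H; cbv beta in W; clear H
    end;
    let j := fresh "j" in let E := fresh "E" in
    remember (@ext2 X A B i ea eb) as j eqn:E; clear E
  end.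

Section OrdinalPrograms.
Variables (X : Type) (i : X -> data) (n : X -> nat).
Hypothesis Hn : fp i (fun x => enc_unary (n x)).

Local Notation eo := (fun x (v : 'I_(n x)) => enc_unary v).

Lemma fp_exists (P : forall x, 'I_(n x) -> bool) :
  fp (ext1 i eo) (fun z => enc_bool (P (tag z) (tagged z))) ->
  fp i (fun x => enc_bool [exists v, P x v]).
Proof.
move=> HP; apply: fp_eq (fp_has (ea := eo) (fp_enum Hn) HP) _ => x; congr enc_bool.
apply/hasP/existsP => [[v _ Pv]|[v Pv]]; first by exists v.
by exists v => //; rewrite mem_enum.
Qed.

Lemma fp_set (P : forall x, 'I_(n x) -> bool) :
  fp (ext1 i eo) (fun z => enc_bool (P (tag z) (tagged z))) ->
  fp i (fun x => enc_set [set v | P x v]).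
Proof.
move=> HP; apply: fp_eq (fp_map (ea := eo) (f := fun x v => enc_bool (P x v)) (fp_enum Hn) HP) _
  => x.
by congr enc_seq; apply: eq_map => v; rewrite inE.
Qed.

Lemma fp_nth_enum (v : forall x, 'I_(n x)) (f : forall x, 'I_(n x) -> data) :
  fp i (fun x => enc_unary (v x)) ->
  fp i (fun x => enc_seq [seq f x w | w <- enum 'I_(n x)]) ->
  fp i (fun x => f x (v x)).
Proof.
move=> Hv Hf; apply: fp_eq (fp_nth Hv Hf) _ => x.
by rewrite (nth_map (v x)) ?size_enum_ord // nth_ord_enum.
Qed.

Lemma fp_in (v : forall x, 'I_(n x)) (A : forall x, {set 'I_(n x)}) :
  fp i (fun x => enc_unary (v x)) -> fp i (fun x => enc_set (A x)) ->
  fp i (fun x => enc_bool (v x \in A x)).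
Proof. by move=> Hv HA; exact: (fp_nth_enum (f := fun x w => enc_bool (w \in A x))). Qed.

Lemma fp_eq_ord (v w : forall x, 'I_(n x)) :
  fp i (fun x => enc_unary (v x)) -> fp i (fun x => enc_unary (w x)) ->
  fp i (fun x => enc_bool (v x == w x)).
Proof. exact: fp_eqn. Qed.

Lemma fp_foldl_ord (B : X -> Type) (eb : forall x, B x -> data)
    (step : forall x, B x -> 'I_(n x) -> B x) (b0 : forall x, B x) :
  fp i (fun x => eb x (b0 x)) ->
  fp (ext2 i eo eb)
    (fun z => eb (tag z) (step (tag z) (tagged z).2 (tagged z).1)) ->
  (exists2 g, bounded i g & forall x b, dsize (eb x b) <= g x) ->
  fp i (fun x => eb x (foldl (step x) (b0 x) (enum 'I_(n x)))).
Proof.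
move=> Hb Hs [g bg Hg].
apply: (@fp_foldl X (fun x => 'I_(n x)) B i eo eb step Hs _ b0) => //.
  exact: fp_enum.
by exists g.
Qed.

Lemma bounded_enc_set : exists2 g, bounded i g &
  forall x (A : {set 'I_(n x)}), dsize (enc_set A) <= g x.
Proof.
exists (fun x => n x * 4 + 1) => [|x A]; last by rewrite addn1 dsize_enc_set.
apply: bounded_add; last exact: bounded_const.
by apply: bounded_mul; [exact: bounded_unary | exact: bounded_const].
Qed.

End OrdinalPrograms.

Definition enc_labels n m (L : {ffun 'I_n -> {set 'I_m}}) : data :=
  enc_seq [seq enc_set (L v) | v <- enum 'I_n].

Section Labels.
Variables (X : Type) (i : X -> data) (n m : X -> nat).
Hypothesis Hn : fp i (fun x => enc_unary (n x)).
Hypothesis Hm : fp i (fun x => enc_unary (m x)).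

Lemma fp_ffun (f : forall x, 'I_(n x) -> {set 'I_(m x)}) :
  fp (ext1 i (fun x (v : 'I_(n x)) => enc_unary v))
    (fun z => enc_set (f (tag z) (tagged z))) ->
  fp i (fun x => enc_labels [ffun v => f x v]).
Proof.
move=> Hf; apply: fp_eq (fp_map (ea := fun x (v : 'I_(n x)) => enc_unary v)
  (f := fun x v => enc_set (f x v)) (fp_enum Hn) Hf) _ => x.
by congr enc_seq; apply: eq_map => v; rewrite ffunE.
Qed.

Lemma fp_app (L : forall x, {ffun 'I_(n x) -> {set 'I_(m x)}}) (v : forall x, 'I_(n x)) :
  fp i (fun x => enc_unary (v x)) -> fp i (fun x => enc_labels (L x)) ->
  fp i (fun x => enc_set (L x (v x))).
Proof. by move=> Hv HL; exact: (fp_nth_enum (f := fun x w => enc_set (L x w))). Qed.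

Lemma bounded_enc_labels : exists2 g, bounded i g &
  forall x (L : {ffun 'I_(n x) -> {set 'I_(m x)}}), dsize (enc_labels L) <= g x.
Proof.
exists (fun x => n x * (m x * 4 + 2) + 1) => [|x L].
  have bn := bounded_unary Hn; have bm := bounded_unary Hm.
  by do ?[apply: bounded_const | apply: bn | apply: bm | apply: bounded_add | apply: bounded_mul].
have Hs v : List.In v (enum 'I_(n x)) -> dsize (enc_set (L v)) <= (m x * 4).+1.
  by move=> _; exact: dsize_enc_set.
by apply: leq_trans (dsize_map_le Hs) _; rewrite size_enum_ord addn2 addn1.
Qed.

End Labels.

Section InstancePrograms.
Variables (X : Type) (i : X -> data) (I : X -> instance).
Hypothesis HI : fp i (fun x => enc_instance (I x)).

Lemma fp_nnodes : fp i (fun x => enc_unary (nnodes (I x))).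
Proof. exact: fp_eq (fp_head HI) _. Qed.

Lemma fp_edges : fp i (fun x => enc_seq
  [seq enc_seq [:: enc_unary (ends (I x) e).1; enc_unary (ends (I x) e).2;
                   enc_rat (cost (I x) e)] | e <- enum (edge (I x))]).
Proof. exact: fp_eq (fp_head (fp_tail HI)) _. Qed.

(** The encoding of an instance stores no edge count, but erasing each entry of its edge list leaves
    that count in unary. *)
Lemma fp_nedges : fp i (fun x => enc_unary (nedges (I x))).
Proof.
pose ed x (e : edge (I x)) := enc_seq [:: enc_unary (ends (I x) e).1;
  enc_unary (ends (I x) e).2; enc_rat (cost (I x) e)].
apply: fp_eq (fp_map (ea := ed) (l := fun x => enum (edge (I x)))
  (f := fun _ _ => Leaf) fp_edges (fp_leaf _)) _ => x.
by rewrite /enc_unary -[nedges _ in RHS]size_enum_ord; elim: (enum _) => //= a l ->.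
Qed.

Variable e : forall x, edge (I x).
Hypothesis He : fp i (fun x => enc_unary (e x)).

Lemma fp_end1 : fp i (fun x => enc_unary (ends (I x) (e x)).1).
Proof. by apply: fp_eq (fp_head (fp_nth_enum He fp_edges)) _. Qed.

Lemma fp_end2 : fp i (fun x => enc_unary (ends (I x) (e x)).2).
Proof. by apply: fp_eq (fp_head (fp_tail (fp_nth_enum He fp_edges))) _. Qed.

Lemma fp_num : fp i (fun x => enc_binary `|numq (cost (I x) (e x))|).
Proof.
by apply: fp_eq (fp_head (fp_head (fp_tail (fp_tail (fp_nth_enum He fp_edges))))) _.
Qed.

Lemma fp_den : fp i (fun x => enc_binary `|denq (cost (I x) (e x))|).
Proof.
by apply: fp_eq (fp_tail (fp_head (fp_tail (fp_tail (fp_nth_enum He fp_edges))))) _.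
Qed.

End InstancePrograms.

(** * Arithmetic on binary numbers *)

Definition lg n := up_log 2 n.+1.

Lemma lg_half n : 0 < n -> lg n = (lg n./2).+1.
Proof. by move=> n0; rewrite /lg up_log2S. Qed.

Lemma bits_half n : 0 < n -> bits n = odd n :: bits n./2.
Proof.
move=> n0; rewrite /bits -!/(lg _) lg_half //= expn0 divn1; congr cons.
rewrite -[1]addn0 iotaDl -map_comp; apply: eq_map => j /=.
by rewrite expnS divnMA divn2.
Qed.

Lemma size_bits n : size (bits n) = lg n.
Proof. by rewrite size_map size_iota. Qed.

Lemma lg_leP n k : (lg n <= k) = (n < 2 ^ k).
Proof.
apply/idP/idP => [le|lt]; last exact: up_log_min.
exact: leq_trans (up_logP n.+1 (isT : 1 < 2)) (leq_pexp2l _ le).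
Qed.

Lemma ltn_lg n : n < 2 ^ lg n. Proof. by rewrite -lg_leP. Qed.

Lemma leq_lg m n : m <= n -> lg m <= lg n.
Proof. by move=> mn; rewrite lg_leP (leq_ltn_trans mn) ?ltn_lg. Qed.

Lemma lg_mul m n : lg (m * n) <= lg m + lg n.
Proof. by rewrite lg_leP expnD; have := ltn_lg m; have := ltn_lg n; nia. Qed.

Lemma lg_add m n : lg (m + n) <= (lg m + lg n).+1.
Proof.
rewrite lg_leP expnS expnD; have := ltn_lg m; have := ltn_lg n.
have : 0 < 2 ^ lg m by rewrite expn_gt0. have : 0 < 2 ^ lg n by rewrite expn_gt0.
nia.
Qed.

Lemma dsize_enc_binary n : dsize (enc_binary n) <= 4 * lg n + 1.
Proof.
have := @dsize_map_le _ enc_bool (bits n) 3 (fun b _ => dsize_enc_bool b).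
by rewrite size_bits mulnC addn1.
Qed.

Lemma lg_dsize n : lg n <= dsize (enc_binary n).
Proof. by rewrite -size_bits -(size_map enc_bool) ltnW // size_enc_seq. Qed.

Section Binary.
Variables (X : Type) (i : X -> data).

Lemma fp_zero : fp i (fun=> enc_binary 0). Proof. exact: fp_leaf. Qed.

Lemma fp_odd n : fp i (fun x => enc_binary (n x)) -> fp i (fun x => enc_bool (odd (n x))).
Proof.
move=> H; apply: fp_eq (fp_head H) _ => x; rewrite /enc_binary.
by case: (posnP (n x)) => [->//|n0]; rewrite bits_half.
Qed.

Lemma fp_half n : fp i (fun x => enc_binary (n x)) -> fp i (fun x => enc_binary (n x)./2).
Proof.
move=> H; apply: fp_eq (fp_tail H) _ => x; rewrite /enc_binary.
by case: (posnP (n x)) => [->//|n0]; rewrite [bits (n x)]bits_half.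
Qed.

(** When [n] and [b] are both zero, no digit is written, which keeps the encoding free of leading
    zeros. *)
Lemma fp_bit_double b n :
  fp i (fun x => enc_bool (b x)) -> fp i (fun x => enc_binary (n x)) ->
  fp i (fun x => enc_binary (b x + (n x).*2)).
Proof.
move=> Hb Hn; have Hc := fp_pair Hb Hn.
apply: fp_eq (fp_case Hn Hc (fp_case Hb Hc (fp_leaf _))) _ => x.
rewrite /enc_binary; case: (posnP (n x)) => [->/=|n0].
  by case: (b x).
rewrite [bits (_ + _)]bits_half ?half_bit_double ?oddD ?odd_double ?addbF ?oddb.
  by rewrite [bits (n x)]bits_half.
by rewrite addn_gt0 double_gt0 n0 orbT.
Qed.

End Binary.

Lemma bounded_lg X (i : X -> data) n :
  fp i (fun x => enc_binary (n x)) -> bounded i (fun x => lg (n x)).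
Proof. by move/fp_bound; apply: bounded_le => x; exact: lg_dsize. Qed.

Lemma fp_foldl_bits X (i : X -> data) (n : X -> nat) (B : X -> Type)
    (eb : forall x, B x -> data) (step : forall x, B x -> bool -> B x)
    (b0 : forall x, B x) :
  fp i (fun x => enc_binary (n x)) -> fp i (fun x => eb x (b0 x)) ->
  fp (ext2 i (fun x => enc_bool) eb)
    (fun z => eb (tag z) (step (tag z) (tagged z).2 (tagged z).1)) ->
  (exists2 g, bounded i g & forall x l, size l <= lg (n x) ->
    dsize (eb x (foldl (step x) (b0 x) l)) <= g x) ->
  fp i (fun x => eb x (foldl (step x) (b0 x) (bits (n x)))).
Proof.
move=> Hn Hb Hs [g bg Hg].
apply: (@fp_foldl X (fun=> bool) B i (fun=> enc_bool) eb step Hs (fun x => bits (n x)) b0) => //.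
exists g => // x l1 l2 E; apply: Hg.
by rewrite -size_bits E size_cat leq_addr.
Qed.

(* An addition state is [(m, n, c, out)]: what remains of the two summands,
   the carry, and the digits produced so far, most significant first. *)
Definition astate := (nat * nat * bool * seq bool)%type.

Definition enc_astate (s : astate) : data :=
  let: (m, n, c, out) := s in
  Node (Node (enc_binary m) (enc_binary n)) (Node (enc_bool c) (enc_seq (map enc_bool out))).

Definition astep (s : astate) : astate :=
  let: (m, n, c, out) := s in
  (m./2, n./2, if odd m then odd n || c else odd n && c,
   ((odd m == odd n) == c) :: out).

Definition digits (l : seq bool) n := foldl (fun n (b : bool) => b + n.*2) n l.

(** The pending sum [m + n + c], placed above the digits already produced. The full adder preserves
    it. *)
Definition avalue (s : astate) := let: (m, n, c, out) := s in digits out (m + n + c).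

Lemma avalue_step s : avalue (astep s) = avalue s.
Proof.
case: s => [[[m n] c] out]; rewrite /avalue /digits /=; congr foldl.
have := odd_double_half m; have := odd_double_half n.
by case: (odd m); case: (odd n); case: c => /=; lia.
Qed.

Lemma fp_astep : fp enc_astate (fun s => enc_astate (astep s)).
Proof.
have Hm : fp enc_astate (fun s => enc_binary s.1.1.1).
  by apply: fp_eq (fp_head (fp_head (fp_id _))) _ => -[[[m n] c] out].
have Hn : fp enc_astate (fun s => enc_binary s.1.1.2).
  by apply: fp_eq (fp_tail (fp_head (fp_id _))) _ => -[[[m n] c] out].
have Hc : fp enc_astate (fun s => enc_bool s.1.2).
  by apply: fp_eq (fp_head (fp_tail (fp_id _))) _ => -[[[m n] c] out].
have Ho : fp enc_astate (fun s => enc_seq (map enc_bool s.2)).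
  by apply: fp_eq (fp_tail (fp_tail (fp_id _))) _ => -[[[m n] c] out].
have H : fp enc_astate (fun s => Node
    (Node (enc_binary s.1.1.1./2) (enc_binary s.1.1.2./2))
    (Node (enc_bool (if odd s.1.1.1 then odd s.1.1.2 || s.1.2 else odd s.1.1.2 && s.1.2))
          (Node (enc_bool ((odd s.1.1.1 == odd s.1.1.2) == s.1.2)) (enc_seq (map enc_bool s.2))))).
  apply: fp_pair; first by apply: fp_pair; exact: fp_half.
  have Hom := fp_odd Hm; have Hon := fp_odd Hn.
  apply: fp_pair; last by apply: fp_pair => //; apply: fp_eqb => //; exact: fp_eqb.
  apply: fp_eq (fp_if Hom (fp_or Hon Hc) (fp_and Hon Hc)) _ => s.
  by case: (odd s.1.1.1).
by apply: fp_eq H _ => -[[[m n] c] out].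
Qed.

(** The carry grows by at most 2, and the new digit takes at most 3 plus its [Node]. *)
Lemma dsize_astep s : dsize (enc_astate (astep s)) <= dsize (enc_astate s) + 6.
Proof.
have half n : dsize (enc_binary n./2) <= dsize (enc_binary n).
  case: (posnP n) => [->//|n0]; rewrite /enc_binary [bits n]bits_half //=; lia.
case: s => [[[m n] c] out] /=; have := half m; have := half n.
set d := ((odd m == odd n) == c); set e := (if odd m then _ else _).
have := dsize_enc_bool d; have := dsize_enc_bool e; have := dsize_gt0 (enc_bool c).
lia.
Qed.

Lemma fp_addn X (i : X -> data) m n :
  fp i (fun x => enc_binary (m x)) -> fp i (fun x => enc_binary (n x)) ->
  fp i (fun x => enc_binary (m x + n x)).
Proof.
move=> Hm Hn.
pose ini x : astate := (m x, n x, false, [::]).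
pose fold (s : astate) (l : seq bool) := foldl (fun s _ => astep s) s l.
have fold_dsize l s : dsize (enc_astate (fold s l)) <= dsize (enc_astate s) + 6 * size l.
  elim: l s => [|b l IH] s /=; first by rewrite addn0.
  by apply: leq_trans (IH _) _; have := dsize_astep s; lia.
have fp_fold k s : fp i (fun x => enc_binary (k x)) -> fp i (fun x => enc_astate (s x)) ->
    fp i (fun x => enc_astate (fold (s x) (bits (k x)))).
  move=> Hk Hs.
  apply: (@fp_foldl_bits X i k (fun=> astate) (fun=> enc_astate)
            (fun x s _ => astep s) s) => //.
    pose h (z : {x : X & (bool * astate)%type}) := (tagged z).2.
    apply: fp_comp (fp_reindex h fp_astep).
    exact: (@fp_acc _ _ _ _ _ (fun=> enc_astate)).
  exists (fun x => dsize (enc_astate (s x)) + 6 * lg (k x)).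
    apply: bounded_add; first exact: fp_bound.
    by apply: bounded_mul; [exact: bounded_const | exact: bounded_lg].
  by move=> x l le; apply: leq_trans (fold_dsize _ _) _; rewrite leq_add2l leq_mul2l le.
have Hi : fp i (fun x => enc_astate (ini x)).
  by apply: fp_pair; [exact: fp_pair | apply: fp_pair; exact: fp_leaf].
(* The digits of both summands together supply enough rounds to exhaust [m] and [n]; the extra
   [astep] turns the last carry into a digit. *)
pose fin x := astep (fold (fold (ini x) (bits (m x))) (bits (n x))).
have Hfin : fp i (fun x => enc_astate (fin x)).
  by apply: fp_comp (fp_fold _ _ Hn (fp_fold _ _ Hm Hi)) _; exact: fp_reindex fp_astep.
have fold_iter s l : fold s l = iter (size l) astep s.
  by elim: l s => //= b l IH s; rewrite IH -iterSr.
have val_fin x : avalue (fin x) = m x + n x.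
  rewrite /fin avalue_step !fold_iter -iterD.
  elim: (_ + _) => [|k IH] /=; last by rewrite avalue_step.
  by rewrite addn0.
have rest k s : (iter k astep s).1.1.1 = s.1.1.1 %/ 2 ^ k /\
                (iter k astep s).1.1.2 = s.1.1.2 %/ 2 ^ k.
  elim: k => [|k [IH1 IH2]] /=; first by rewrite expn0 !divn1.
  case: (iter k astep s) IH1 IH2 => [[[m' n'] c] out] /= -> ->.
  by rewrite expnSr !divnMA !divn2.
have fin0 x : exists out, fin x = (0, 0, false, out).
  rewrite /fin !fold_iter -iterD !size_bits.
  have := rest (lg (n x) + lg (m x)) (ini x) => -[].
  have -> : (ini x).1.1.1 %/ 2 ^ (lg (n x) + lg (m x)) = 0.
    rewrite divn_small //= expnD; have := ltn_lg (m x).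
    by have : 0 < 2 ^ lg (n x) by [rewrite expn_gt0]; nia.
  have -> : (ini x).1.1.2 %/ 2 ^ (lg (n x) + lg (m x)) = 0.
    rewrite divn_small //= expnD; have := ltn_lg (n x).
    by have : 0 < 2 ^ lg (m x) by [rewrite expn_gt0]; nia.
  by case: (iter _ _ _) => [[[m' n'] c] out] /= -> ->; eexists.
have Ho : fp i (fun x => enc_seq (map enc_bool (fin x).2)).
  apply: fp_eq (fp_tail (fp_tail Hfin)) _ => x.
  by case: (fin x) => [[[m' n'] c] out].
have E x : m x + n x = digits (fin x).2 0.
  by rewrite -val_fin; have [out ->] := fin0 x.
(* The list of produced digits may start with zeros at the most significant end. Rebuilding the
   number digit by digit with [fp_bit_double] drops them. *)
suff H : fp i (fun x => enc_binary (digits (fin x).2 0)).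
  by apply: fp_eq H _ => x; rewrite E.
have size_fin x : size (fin x).2 = (lg (n x) + lg (m x)).+1.
  rewrite /fin !fold_iter -iterD !size_bits -iterS; elim: (_.+1) => //= k.
  by case: (iter k _ _) => [[[m' n'] c] out] /= ->.
pose eb (x : X) k := enc_binary k.
apply: (@fp_foldl X (fun=> bool) (fun=> nat) i (fun=> enc_bool) eb
  (fun x n (b : bool) => b + n.*2) _ (fun x => (fin x).2) (fun=> 0)) => //.
- by apply: fp_bit_double; [exact: fp_elt | exact: (@fp_acc _ _ _ _ _ eb)].
- exact: fp_zero.
exists (fun x => 4 * (lg (n x) + lg (m x) + 1) + 1).
  apply: bounded_add; last exact: bounded_const.
  apply: bounded_mul; first exact: bounded_const.
  by do !apply: bounded_add => //; [exact: bounded_lg|exact: bounded_lg|exact: bounded_const].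
move=> x l1 l2 El; apply: leq_trans (dsize_enc_binary _) _.
rewrite leq_add2r leq_mul2l /= lg_leP addn1 -size_fin El size_cat.
have : foldl (fun n (b : bool) => b + n.*2) 0 l1 < 2 ^ size l1.
  elim/last_ind: l1 {El} => [|l b IH] //; rewrite -cats1 foldl_cat size_cat addn1 expnS /=.
  by case: b; lia.
move=> H; apply: leq_trans H _; exact: leq_pexp2l (leq_addr _ _).
Qed.

Lemma bits_ind (P : nat -> Prop) :
  P 0 -> (forall n, 0 < n -> P n./2 -> P n) -> forall n, P n.
Proof.
move=> P0 PS n; have [k] := ubnP n; elim: k n => // k IH n nk.
case: (posnP n) => [->//|n0]; apply: PS => //; apply: IH.
by rewrite -divn2; apply: leq_ltn_trans (leq_div2r 2 _) _; [exact: nk|]; lia.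
Qed.

Lemma fp_muln X (i : X -> data) m n :
  fp i (fun x => enc_binary (m x)) -> fp i (fun x => enc_binary (n x)) ->
  fp i (fun x => enc_binary (m x * n x)).
Proof.
move=> Hm Hn.
pose enc2 (x : X) (s : nat * nat) := Node (enc_binary s.1) (enc_binary s.2).
(* Shift and add: the state holds the product so far and the shifted first factor. *)
pose step (x : X) (s : nat * nat) (b : bool) :=
  (if b then s.1 + s.2 else s.1, s.2 + s.2).
pose fin x := foldl (step x) (0, m x) (bits (n x)).
suff H : fp i (fun x => enc2 x (fin x)).
  apply: fp_eq (fp_head H) _ => x /=; congr enc_binary; rewrite /fin.
  rewrite -[RHS]add0n; move: 0 (m x); elim/bits_ind: (n x) => [|k k0 IH] s a.
    by rewrite /= muln0 addn0.
  rewrite bits_half //= IH; have := odd_double_half k.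
  by case: (odd k) => /=; nia.
apply: (fp_foldl_bits (step := step)) => //.
- by apply: fp_pair => //; exact: fp_zero.
- have H : fp (ext2 i (fun=> enc_bool) enc2) (fun z => enc2 (tag z) (tagged z).2).
    exact: fp_acc.
  have H1 : fp (ext2 i (fun=> enc_bool) enc2) (fun z => enc_binary (tagged z).2.1).
    exact: fp_eq (fp_head H) _.
  have H2 : fp (ext2 i (fun=> enc_bool) enc2) (fun z => enc_binary (tagged z).2.2).
    exact: fp_eq (fp_tail H) _.
  apply: fp_pair; last exact: fp_addn.
  apply: fp_eq (fp_if (fp_elt _ _ _) (fp_addn H1 H2) H1) _ => -[x [[] s]] //.
have bg : bounded i (fun x => 4 * (2 * lg (n x) + lg (m x)) + 1).
  by do ?[apply: bounded_const | apply: bounded_add | apply: bounded_mul | exact: bounded_lg].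
exists (fun x => 1 + (4 * (2 * lg (n x) + lg (m x)) + 1) +
                 (4 * (2 * lg (n x) + lg (m x)) + 1)).
  by do ?[apply: bounded_const | apply: bg | apply: bounded_add].
move=> x l le.
(* A step at most triples the sum of the two components, so two binary digits per step are
   enough. *)
have : (foldl (step x) (0, m x) l).1 + (foldl (step x) (0, m x) l).2 < 2 ^ (2 * size l + lg (m x)).
  elim/last_ind: l {le} => [|l b IH]; first exact: ltn_lg.
  rewrite -cats1 foldl_cat /= size_cat mulnDr addnAC expnD addnC.
  by case: b => /=; lia.
set s := foldl _ _ _ => lts.
have le1 : lg s.1 <= 2 * lg (n x) + lg (m x).
  rewrite lg_leP; apply: leq_trans (leq_ltn_trans (leq_addr s.2 _) lts) _.
  by rewrite leq_pexp2l // leq_add2r leq_mul2l.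
have le2 : lg s.2 <= 2 * lg (n x) + lg (m x).
  rewrite lg_leP; apply: leq_trans (leq_ltn_trans (leq_addl s.1 _) lts) _.
  by rewrite leq_pexp2l // leq_add2r leq_mul2l.
rewrite /enc2 /=; have := dsize_enc_binary s.1; have := dsize_enc_binary s.2.
lia.
Qed.

Lemma fp_leq X (i : X -> data) m n :
  fp i (fun x => enc_binary (m x)) -> fp i (fun x => enc_binary (n x)) ->
  fp i (fun x => enc_bool (m x <= n x)).
Proof.
move=> Hm Hn.
pose state := (nat * nat * bool)%type.
pose enc3 (x : X) (s : state) :=
  Node (Node (enc_binary s.1.1) (enc_binary s.1.2)) (enc_bool s.2).
(* Digits arrive least significant first, so a later pair of different digits overrides the verdict.
   The verdict starts at [true] because equality counts as success. *)
pose next (s : state) : state :=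
  (s.1.1./2, s.1.2./2, if odd s.1.1 == odd s.1.2 then s.2 else odd s.1.2).
pose step (x : X) (s : state) (_ : bool) := next s.
pose fin x := foldl (step x) (m x, n x, true) (bits (m x + n x)).
have fold_iter x s l : foldl (step x) s l = iter (size l) next s.
  by elim: l s => //= b l IH s; rewrite IH -iterSr.
have iterE k s : (iter k next s).1 = (s.1.1 %/ 2 ^ k, s.1.2 %/ 2 ^ k).
  elim: k => [|k IH] /=; first by rewrite expn0 !divn1; case: s => [[]].
  by rewrite IH /= expnSr !divnMA !divn2.
suff H : fp i (fun x => enc3 x (fin x)).
  apply: fp_eq (fp_tail H) _ => x /=; congr enc_bool.
  (* The invariant: what remains of the two numbers decides, and a tie falls back on the verdict
     from the digits already read. *)
  pose val (s : state) := if s.1.1 == s.1.2 then s.2 else s.1.1 < s.1.2.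
  have val_next s : val (next s) = val s.
    case: s => [[a b] c]; rewrite /val /=.
    have := odd_double_half a; have := odd_double_half b.
    case: (odd a); case: (odd b) => /= ? ?; case: eqP => ?; case: eqP => ?; lia.
  have : val (fin x) = (m x <= n x).
    rewrite /fin fold_iter; elim: (size _) => [|k IH]; last by rewrite iterS val_next.
    by rewrite /val /=; case: eqP => ?; lia.
  rewrite /val /fin fold_iter iterE /= size_bits !divn_small //.
    by rewrite -lg_leP leq_lg // leq_addl.
  by rewrite -lg_leP leq_lg // leq_addr.
have H0 := fp_addn Hm Hn.
apply: (fp_foldl_bits (step := step)) => //.
- by apply: fp_pair; [exact: fp_pair | exact: fp_true].
- have H : fp (ext2 i (fun=> enc_bool) enc3) (fun z => enc3 (tag z) (tagged z).2).
    exact: fp_acc.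
  have H1 : fp (ext2 i (fun=> enc_bool) enc3) (fun z => enc_binary (tagged z).2.1.1).
    exact: fp_eq (fp_head (fp_head H)) _.
  have H2 : fp (ext2 i (fun=> enc_bool) enc3) (fun z => enc_binary (tagged z).2.1.2).
    exact: fp_eq (fp_tail (fp_head H)) _.
  have H3 : fp (ext2 i (fun=> enc_bool) enc3) (fun z => enc_bool (tagged z).2.2).
    exact: fp_eq (fp_tail H) _.
  apply: fp_pair; first by apply: fp_pair; exact: fp_half.
  have H4 := fp_odd H2.
  apply: fp_eq (fp_if (fp_eqb (fp_odd H1) H4) H3 H4) _ => z.
  by rewrite /=; case: eqP.
exists (fun x => (5 + 4 * lg (m x)) + (4 * lg (n x) + 2)).
  by do ?[apply: bounded_const | apply: bounded_add | apply: bounded_mul | exact: bounded_lg].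
move=> x l _; rewrite fold_iter /enc3 iterE /=; set b := (_.2 : bool).
have := dsize_enc_binary (m x %/ 2 ^ size l); have := dsize_enc_binary (n x %/ 2 ^ size l).
have := leq_lg (leq_div (m x) (2 ^ size l)); have := leq_lg (leq_div (n x) (2 ^ size l)).
have := dsize_enc_bool b; lia.
Qed.

(* Costs are added as unreduced fractions: the common denominator is at most
   the product of the given ones. *)
Definition cost_frac (I : instance) (K : {set edge I}) : nat * nat :=
  foldl (fun s e => if e \in K then
      (s.1 * `|denq (cost I e)| + `|numq (cost I e)| * s.2, s.2 * `|denq (cost I e)|)
    else s) (0, 1) (enum (edge I)).

Lemma cost_fracP (I : instance) (K : {set edge I}) :
  (forall e, 0 <= cost I e)%R ->
  0 < (cost_frac K).2 /\
  total_cost K = ((cost_frac K).1%:R / (cost_frac K).2%:R)%R.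
Proof.
move=> c0; rewrite /total_cost big_mkcond -big_enum /= /cost_frac.
elim/last_ind: (enum _) => [|l e [IH0 IH]]; first by rewrite big_nil mul0r.
rewrite -cats1 foldl_cat big_cat big_seq1 /= IH; set s := foldl _ _ _ in IH0 *.
case: ifP => _; last by rewrite addr0.
have d0 : 0 < `|denq (cost I e)| by rewrite absz_gt0 denq_eq0.
split; first by rewrite muln_gt0 IH0.
have numE : ((numq (cost I e))%:~R = `|numq (cost I e)|%N%:R :> rat)%R.
  by rewrite -[in LHS](gez0_abs (m := numq (cost I e))) ?numq_ge0.
have denE : ((denq (cost I e))%:~R = `|denq (cost I e)|%N%:R :> rat)%R.
  by rewrite -[in LHS]absz_denq.
rewrite -[cost I e in LHS]divq_num_den numE denE natrD !natrM addf_div //.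
  by rewrite pnatr_eq0 -lt0n.
by rewrite pnatr_eq0 -lt0n.
Qed.

Lemma total_cost_leq (I : instance) (K L : {set edge I}) :
  (forall e, 0 <= cost I e)%R ->
  (total_cost K <= total_cost L)%R =
  ((cost_frac K).1 * (cost_frac L).2 <= (cost_frac L).1 * (cost_frac K).2).
Proof.
move=> c0; have [K0 ->] := cost_fracP K c0; have [L0 ->] := cost_fracP L c0.
by rewrite ler_pdivrMr ?ltr0n // mulrAC ler_pdivlMr ?ltr0n // -!natrM ler_nat.
Qed.

Lemma lg_cost (I : instance) (e : edge I) :
  lg (`|numq (cost I e)| + `|denq (cost I e)|) <= dsize (enc_instance I).
Proof.
apply: leq_trans (lg_add _ _) _.
have : dsize (enc_rat (cost I e)) <= dsize (enc_instance I).
  rewrite /enc_instance [enc_seq (_ :: _)]/=.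
  have : e \in enum (edge I) by rewrite mem_enum.
  have E l : e \in l -> dsize (enc_rat (cost I e)) <= dsize (enc_seq
    [seq enc_seq [:: enc_unary (ends I e).1; enc_unary (ends I e).2;
                     enc_rat (cost I e)] | e <- l]).
    by elim: l => // f l IH; rewrite inE => /orP[/eqP<-|/IH] /=; lia.
  by move/E; rewrite /=; lia.
have := lg_dsize `|numq (cost I e)|; have := lg_dsize `|denq (cost I e)|.
by rewrite /enc_rat /=; lia.
Qed.

Section CostPrograms.
Variables (X : Type) (i : X -> data) (I : X -> instance).
Hypothesis HI : fp i (fun x => enc_instance (I x)).

Lemma fp_cost_frac (K : forall x, {set edge (I x)}) :
  fp i (fun x => enc_set (K x)) ->
  fp i (fun x => Node (enc_binary (cost_frac (K x)).1) (enc_binary (cost_frac (K x)).2)).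
Proof.
move=> HK; have Hm := fp_nedges HI.
pose enc2 (x : X) (s : nat * nat) := Node (enc_binary s.1) (enc_binary s.2).
pose step x (s : nat * nat) (e : edge (I x)) := if e \in K x then
    (s.1 * `|denq (cost (I x) e)| + `|numq (cost (I x) e)| * s.2, s.2 * `|denq (cost (I x) e)|)
  else s.
apply: (@fp_foldl X (fun x => edge (I x)) (fun=> nat * nat)%type i
  (fun x e => enc_unary e) enc2 step _ (fun x => enum (edge (I x))) (fun=> (0, 1))).
- set j := ext2 _ _ _.
  have He : fp j (fun z => enc_unary (tagged z).1) by exact: fp_elt.
  have Hs : fp j (fun z => enc2 (tag z) (tagged z).2) by exact: fp_acc.
  have H1 : fp j (fun z => enc_binary (tagged z).2.1).
    by apply: fp_eq (fp_head Hs) _ => z.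
  have H2 : fp j (fun z => enc_binary (tagged z).2.2).
    by apply: fp_eq (fp_tail Hs) _ => z.
  have HI' : fp j (fun z => enc_instance (I (tag z))).
    exact: (fp_env2 _ _ HI).
  have HK' : fp j (fun z => enc_set (K (tag z))).
    exact: (fp_env2 _ _ HK).
  have Hd := fp_den HI' He; have Hn := fp_num HI' He.
  have Hin := fp_in He HK'.
  apply: fp_eq (fp_if Hin (fp_pair (fp_addn (fp_muln H1 Hd) (fp_muln Hn H2)) (fp_muln H2 Hd)) Hs) _.
  by move=> z; rewrite /step; case: ifP.
- exact: fp_enum.
- apply: fp_pair; first exact: fp_zero.
  by apply: fp_eq (fp_bit_double (fp_true _) (fp_zero _)) _.
pose D x := dsize (enc_instance (I x)).
have bD : bounded i D by exact: fp_bound.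
have bm : bounded i (fun x => nedges (I x)) := bounded_unary Hm.
exists (fun x => 1 + (4 * (1 + nedges (I x) * D x) + 1) + (4 * (1 + nedges (I x) * D x) + 1)).
  by do ?[apply: bounded_const | apply: bD | apply: bm | apply: bounded_add | apply: bounded_mul].
move=> x l1 l2 El; set s := foldl _ _ _.
(* Adding one cost multiplies the sum of numerator and denominator by at most the same sum for that
   cost, whose length is bounded by [lg_cost]. *)
have : lg (s.1 + s.2) <= 1 + size l1 * D x.
  rewrite /s; elim/last_ind: l1 {El s} => [|l e IH] //.
  rewrite -cats1 foldl_cat size_cat mulnDl mul1n addnA.
  set s := foldl _ _ _ in IH *; rewrite /= /step; case: ifP => _;
    last exact: leq_trans IH (leq_addr _ _).
  apply: leq_trans (leq_add IH (lg_cost e)); apply: leq_trans (lg_mul _ _); apply: leq_lg.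
  by rewrite /=; nia.
have : size l1 <= nedges (I x).
  have := size_enum_ord (nedges (I x)); rewrite El size_cat => E.
  by rewrite -[X in _ <= X]E leq_addr.
move=> lem; have := leq_mul lem (leqnn (D x)); rewrite /enc2 /= => lemd les.
have := leq_trans (leq_lg (leq_addr s.2 s.1)) les.
have := leq_trans (leq_lg (leq_addl s.1 s.2)) les.
have := dsize_enc_binary s.1; have := dsize_enc_binary s.2.
lia.
Qed.

Lemma fp_cost_leq (K L : forall x, {set edge (I x)}) :
  (forall x e, 0 <= cost (I x) e)%R ->
  fp i (fun x => enc_set (K x)) -> fp i (fun x => enc_set (L x)) ->
  fp i (fun x => enc_bool (total_cost (K x) <= total_cost (L x))%R).
Proof.
move=> c0 /fp_cost_frac HK /fp_cost_frac HL.
have [HK1 HK2] := (fp_eq (fp_head HK) (fun=> erefl), fp_eq (fp_tail HK) (fun=> erefl)).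
have [HL1 HL2] := (fp_eq (fp_head HL) (fun=> erefl), fp_eq (fp_tail HL) (fun=> erefl)).
apply: fp_eq (fp_leq (fp_muln HK1 HL2) (fp_muln HL1 HK2)) _ => x.
by rewrite total_cost_leq.
Qed.

End CostPrograms.

Local Open Scope ring_scope.

(** * Connectivity and cores *)

Section Graph.
Variable I : instance.
Implicit Types (J K : {set edge I}) (A : {set node I}) (e : edge I) (s t u v : node I).

Definition adj J u v : bool := [exists e in J, joins e u v].

Definition conn J := connect (adj J).

Definition reach_step J A : {set node I} :=
  [set v | (v \in A) || [exists e, (e \in J) &&
     (((ends I e).1 \in A) && ((ends I e).2 == v) ||
      ((ends I e).2 \in A) && ((ends I e).1 == v))]].

(** An explicit iteration, so that it can be programmed; [in_component] identifies it with [conn]. A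
    simple path uses each edge at most once, so [nedges I] rounds suffice. *)
Definition component J s : {set node I} := iter (nedges I) (reach_step J) [set s].

Lemma joins_sym e u v : joins e u v = joins e v u.
Proof. by rewrite /joins orbC. Qed.

Lemma joins_ends e : joins e (ends I e).1 (ends I e).2.
Proof. by rewrite /joins -surjective_pairing eqxx. Qed.

Lemma joins_endsP e u v : joins e u v ->
  ((ends I e).1 = u /\ (ends I e).2 = v) \/ ((ends I e).1 = v /\ (ends I e).2 = u).
Proof. by case/orP => /eqP ->; [left | right]. Qed.

Lemma adj_sym J : symmetric (adj J).
Proof. by move=> u v; apply: eq_existsb => e; rewrite joins_sym. Qed.

Lemma conn_sym J u v : conn J u v = conn J v u.
Proof. exact: (sym_connect_sym (@adj_sym J)). Qed.

Lemma conn_refl J u : conn J u u. Proof. exact: connect0. Qed.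

Lemma conn_trans J v u w : conn J u v -> conn J v w -> conn J u w.
Proof. exact: connect_trans. Qed.

Lemma adj_joins J e u v : e \in J -> joins e u v -> adj J u v.
Proof. by move=> eJ j; apply/existsP; exists e; rewrite eJ. Qed.

Lemma conn_joins J e u v : e \in J -> joins e u v -> conn J u v.
Proof. by move=> eJ j; apply/connect1/(adj_joins eJ j). Qed.

Lemma conn_ends J e : e \in J -> conn J (ends I e).1 (ends I e).2.
Proof. by move=> eJ; apply: conn_joins eJ (joins_ends e). Qed.

Lemma conn_sub J K u v : J \subset K -> conn J u v -> conn K u v.
Proof.
move=> /subsetP JK; apply: connect_sub => {}u {}v /existsP[e /andP[eJ j]].
by apply: conn_joins (JK _ eJ) j.
Qed.

(* The rest of a simple path from [s] avoids [s], hence does not use the first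
   edge. *)
Lemma conn_first J s v : conn J s v -> s != v ->
  exists e u, [/\ e \in J, joins e s u & conn (J :\ e) u v].
Proof.
move=> /connectP[p0 p0P ->]; case/shortenP: p0P => [[|u p]] /=; first by rewrite eqxx.
move=> /andP[/existsP[e /andP[eJ j]] pP] /andP[sp _] _ _.
exists e, u; split=> //; apply/connectP; exists p => //.
rewrite inE negb_or in sp; case/andP: sp => su sp.
have ne w x : w != s -> x != s -> adj J w x -> adj (J :\ e) w x.
  move=> ws xs /existsP[f /andP[fJ jf]]; apply: (adj_joins _ jf).
  rewrite !inE fJ andbT; apply: contraTneq jf => ->; apply/negP => jf.
  have := joins_endsP j; have := joins_endsP jf; rewrite !(eq_sym _ s) in ws xs.
  by move=> [[-> ->]|[-> ->]] [[E _]|[_ E]]; rewrite E eqxx in ws xs.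
elim: p u su {j} pP sp => //= w p IH u su /andP[a pP].
rewrite inE negb_or => /andP[sw sp]; rewrite IH // andbT.
by apply: ne => //; rewrite eq_sym.
Qed.

Lemma conn_last J s v : conn J s v -> s != v ->
  exists e u, [/\ e \in J, joins e u v & conn (J :\ e) s u].
Proof.
rewrite conn_sym eq_sym => c vs; have [e [u [eJ j c']]] := conn_first c vs.
by exists e, u; rewrite joins_sym conn_sym.
Qed.

Lemma in_component J s v : (v \in component J s) = conn J s v.
Proof.
apply/idP/idP; rewrite /component.
  elim: (nedges I) v => [|k IH] v /=; first by rewrite inE => /eqP->; exact: conn_refl.
  rewrite inE => /orP[/IH//|/existsP[e /andP[eJ /orP[]/andP[/IH c /eqP <-]]]].
    exact: conn_trans c (conn_ends eJ).
  by apply: conn_trans c _; rewrite conn_sym conn_ends.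
(* The induction is on the size of an edge set that connects [s] to [w], because [conn_last] removes
   an edge from this set. *)
suff H k K w : (#|K| <= k)%N -> K \subset J -> conn K s w ->
    w \in iter k (reach_step J) [set s].
  by apply: H => //; rewrite -[X in (_ <= X)%N]card_ord max_card.
elim: k K w => [|k IH] K w cK KJ c.
  rewrite inE; apply: contraT; rewrite eq_sym => sw.
  have [e [u [eK _ _]]] := conn_first c sw.
  by move: cK; rewrite leqn0 cards_eq0 => /eqP K0; rewrite K0 inE in eK.
rewrite iterS inE; case: (eqVneq s w) => [<-|sw].
  apply/orP; left; elim: k {IH cK} => [|k IH]; first by rewrite inE.
  by rewrite iterS inE IH.
have [e [u [eK j c']]] := conn_last c sw.
apply/orP; right; apply/existsP; exists e; rewrite (subsetP KJ) //=.
have uI : u \in iter k (reach_step J) [set s].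
  apply: (IH (K :\ e)) => //; last exact: subset_trans (subsetDl _ _) KJ.
  by move: cK; rewrite (cardsD1 e) eK.
by case: (joins_endsP j) => -[-> ->]; rewrite uI eqxx ?orbT.
Qed.

Lemma mem_component J s : s \in component J s. Proof. by rewrite in_component conn_refl. Qed.

Lemma eq_component J s t : conn J s t -> component J s = component J t.
Proof.
move=> c; apply/setP => v; rewrite !in_component.
by apply/idP/idP => [d|]; [rewrite conn_sym in c; exact: conn_trans c d | exact: conn_trans].
Qed.

Definition crossed J A : bool := [exists e in J, covers_set e A].

(** Uncrossed sets are the unions of components of [J], that is, the sets that survive
    contraction. *)
Lemma uncrossedP J A :
  reflect (forall u v, conn J u v -> u \in A -> v \in A) (~~ crossed J A).
Proof.
apply: (iffP idP) => [nc u v /connectP[p pP ->]|H].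
  elim: p u pP => //= w p IH u /andP[/existsP[e /andP[eJ j]] pP] uA; apply: IH pP _.
  apply: contraR nc => wA; apply/existsP; exists e; rewrite eJ /=.
  by rewrite /covers_set; case: (joins_endsP j) => -[-> ->]; rewrite uA (negbTE wA).
apply/negP => /existsP[e /andP[eJ]]; rewrite /covers_set.
have c := conn_ends eJ; have c' := c; rewrite conn_sym in c'.
have := H _ _ c; have := H _ _ c'; do 2?case: (_ \in A) => //=.
  by move=> /(_ isT).
by move=> _ /(_ isT).
Qed.

Lemma crossed_component J K s : J \subset K -> ~~ crossed J (component K s).
Proof.
move=> JK; apply/uncrossedP => u v c; rewrite !in_component => d.
exact: conn_trans d (conn_sub JK c).
Qed.

Lemma uncrossed_component J s A : ~~ crossed J A -> s \in A -> component J s \subset A.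
Proof. by move=> /uncrossedP H sA; apply/subsetP => v; rewrite in_component => /H; exact. Qed.

Lemma uncrossed_sub J K A : J \subset K -> ~~ crossed K A -> ~~ crossed J A.
Proof.
by move=> JK /uncrossedP H; apply/uncrossedP => u v /(conn_sub JK); exact: H.
Qed.

Lemma uncrossedD J A B : ~~ crossed J A -> ~~ crossed J B -> ~~ crossed J (A :\: B).
Proof.
move=> /uncrossedP HA /uncrossedP HB; apply/uncrossedP => u v c; rewrite !inE.
move=> /andP[uB uA]; rewrite (HA _ _ c uA) andbT; apply: contra uB.
by apply: HB; rewrite conn_sym.
Qed.

End Graph.

(** * Cores of residual families *)

Section Cores.
Variables (I : instance) (F : {set {set node I}}).
Implicit Types (J K : {set edge I}) (A B C : {set node I}) (e : edge I) (s t u v : node I).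

Lemma in_residual J A : (A \in residual F J) = (A \in F) && ~~ crossed J A.
Proof. by rewrite inE. Qed.

Lemma component_residual J s : (component J s \in residual F J) = (component J s \in F).
Proof. by rewrite in_residual crossed_component ?andbT. Qed.

Lemma residual_sub J K A : J \subset K -> A \in residual F K -> A \in residual F J.
Proof.
by move=> JK; rewrite !in_residual => /andP[-> /(uncrossed_sub JK)].
Qed.

(** If [set0] belongs to the family, it is the only core of every residual family and nothing can
    cover it. The second conjunct then switches off every node, and it can be tested with assumption
    1. *)
Definition core J s : bool :=
  (component J s \in residual F J) && (set0 \notin residual F J).

Lemma core_conn J s t : conn J s t -> core J s = core J t.
Proof. by rewrite /core => /eq_component ->. Qed.

Lemma set0_residual J : (set0 \in residual F J) = (set0 \in F).
Proof.
rewrite in_residual; case: (_ \in F) => //=.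
by apply/uncrossedP => u v _; rewrite inE.
Qed.

Hypothesis F0 : set0 \notin F.

Lemma coreE J s : core J s = (component J s \in F).
Proof. by rewrite /core set0_residual F0 andbT component_residual. Qed.

Hypothesis compF : disjointness_compliable F.

Lemma residual_core J A : A \in residual F J ->
  exists s, [/\ s \in A, core J s & component J s \subset A].
Proof.
have [k] := ubnP #|A|; elim: k A => // k IH A cA AF.
have [A0|[s sA]] := set_0Vmem A; first by rewrite A0 set0_residual (negbTE F0) in AF.
move: AF; rewrite in_residual => /andP[AF nA].
have sub := uncrossed_component nA sA.
have [sF|DF] := compF sub AF; first by exists s; rewrite coreE.
have DR : A :\: component J s \in residual F J.
  by rewrite in_residual DF uncrossedD ?crossed_component.
have [|t [tD ct sD]] := IH _ _ DR.
  apply: leq_trans (_ : #|A| <= k)%N => //; apply: proper_card.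
  rewrite properE subsetDl /=; apply/subsetPn; exists s => //.
  by rewrite inE mem_component.
exists t; split=> //; first by move: tD; rewrite inE => /andP[].
exact: subset_trans sD (subsetDl _ _).
Qed.

Lemma core_cores J s : core J s -> component J s \in cores (residual F J).
Proof.
move=> cs; rewrite inE; apply/minsetP; split; first by case/andP: cs.
move=> B BR Bs; have [t [tB _ tsub]] := residual_core BR.
apply/eqP; rewrite eqEsubset Bs /=; apply: subset_trans tsub.
by have := subsetP Bs _ tB; rewrite in_component => /eq_component ->.
Qed.

Lemma coresP J C : reflect (exists2 s, core J s & C = component J s) (C \in cores (residual F J)).
Proof.
apply: (iffP idP) => [|[s cs ->]]; last exact: core_cores.
rewrite inE => /minsetP[CR minC].
have [s [_ cs sub]] := residual_core CR; exists s => //.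
by apply/esym/minC => //; case/andP: cs.
Qed.

Lemma component_eq J s t v :
  v \in component J s -> v \in component J t -> component J s = component J t.
Proof. by rewrite !in_component => /eq_component -> /eq_component ->. Qed.

(** A certificate of progress that needs only membership queries on components; the cores are never
    listed. *)
Definition good J K : bool :=
  [exists s, core J s && (~~ core K s ||
     [exists t, core J t && ((t \in component K s) && (t \notin component J s))])].

(** The map [g] sends each new core to an old core inside it other than the component of [s]. It is
    injective because new cores are disjoint, and it misses that component. If the only old core
    inside a new core were the component of [s], the new core would be [component K s]: a core that
    swallows no other old core, against [good J K]. *)
Lemma good_cores J K : J \subset K -> good J K ->
  (#|cores (residual F K)| < #|cores (residual F J)|)%N.
Proof.
move=> JK /existsP[s /andP[cs bad]].
have [->|[D0 D0K]] := set_0Vmem (cores (residual F K)).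
  by rewrite cards0 card_gt0; apply/set0Pn; exists (component J s); exact: core_cores.
pose P (D C : {set node I}) := [&& C \in cores (residual F J), C \subset D & C != component J s].
pose g (D : {set node I}) : {set node I} := odflt set0 [pick C | P D C].
have gP D : D \in cores (residual F K) -> P D (g D).
  move=> DK; rewrite /g; case: pickP => //= noC; case/coresP: DK => d cd ED.
  have DK0 : D \in residual F K by rewrite ED; case/andP: cd.
  have DR : D \in residual F J by apply: residual_sub JK _; rewrite ED; case/andP: cd.
  have [c [cD cc sub]] := residual_core DR.
  have := noC (component J c); rewrite /P core_cores // sub /= => /negbFE/eqP Ecs.
  have sD : s \in D by rewrite (subsetP sub) // Ecs mem_component.
  have {}ED : D = component K s
    by rewrite ED; apply: (component_eq (v := s)); rewrite -?ED ?mem_component.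
  have csK : core K s by rewrite coreE -ED; move: DK0; rewrite in_residual => /andP[].
  case/orP: bad; first by rewrite csK.
  case/existsP => t /and3P[ct tK tJ].
  have := noC (component J t); rewrite /P core_cores //= => /negbT; rewrite negb_and negbK.
  case/orP => [/negP[]|/eqP E].
    rewrite ED; apply: uncrossed_component; rewrite ?crossed_component //.
  by rewrite -E mem_component in tJ.
have ginj : {in cores (residual F K) &, injective g}.
  move=> D E DK EK gDE; have /and3P[gD sD _] := gP _ DK; have /and3P[_ sE _] := gP _ EK.
  case/coresP: gD => c _ Ec.
  have cD : c \in D by rewrite (subsetP sD) // Ec mem_component.
  have cE : c \in E by rewrite (subsetP sE) // -gDE Ec mem_component.
  case/coresP: DK cD => d _ ->; case/coresP: EK cE => e _ ->.
  by move=> /[swap]; exact: component_eq.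
rewrite -(card_in_imset ginj) (cardsD1 (component J s) (cores (residual F J))) core_cores //=.
rewrite add1n ltnS; apply: subset_leq_card; apply/subsetP => C /imsetP[D DK ->].
by have /and3P[gD _ ne] := gP _ DK; rewrite !inE in gD *; rewrite ne gD.
Qed.

Lemma residual0_covers J : covers J F = (residual F J == set0).
Proof.
apply/forall_inP/eqP => [H|R0 A AF].
  apply/setP => A; rewrite in_residual inE; apply/negP => /andP[AF].
  by rewrite /crossed H.
apply: contraT => nA; have : A \in residual F J by rewrite in_residual AF; exact: nA.
by rewrite R0 inE.
Qed.

Lemma residual_eq0 J : (residual F J == set0) = ~~ [exists s, core J s].
Proof.
apply/idP/idP => [/eqP R0|].
  by apply/existsPn => s; rewrite /core R0 inE.
apply: contraR => /set0Pn[A /residual_core[s [_ cs _]]].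
by apply/existsP; exists s.
Qed.

Lemma residual_set0 : residual F set0 = F.
Proof.
apply/setP => A; rewrite in_residual -[RHS]andbT; congr andb.
by apply/existsPn => e; rewrite inE.
Qed.

(** The edges that may occur in a restricted cover of the core of [s]: every such cover is a subset
    of this set. *)
Definition avoid J s : {set edge I} :=
  [set e | (((ends I e).1 \in component J s) || ~~ core J (ends I e).1) &&
           (((ends I e).2 \in component J s) || ~~ core J (ends I e).2)].

(** The guard for calls to the program of assumption 2: by [restricted_avoid] and
    [restricted_coverable] it decides whether a core has a restricted cover. *)
Definition coverable J s : bool := core J s && ~~ core (J :|: avoid J s) s.

Lemma component_avoid J s t : core J t -> t \notin component J s ->
  component (J :|: avoid J s) t = component J t.
Proof.
move=> ct ts; apply/eqP; rewrite eqEsubset; apply/andP; split; last first.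
  by apply/subsetP => v; rewrite !in_component; apply: conn_sub; exact: subsetUl.
apply: uncrossed_component (mem_component _ _); apply/existsPn => e; rewrite !inE.
have out v : v \in component J t -> (v \in component J s) || ~~ core J v = false.
  rewrite !in_component => c; rewrite -(core_conn c) ct orbF; apply: contraNF ts => d.
  by rewrite in_component; apply: conn_trans d _; rewrite conn_sym.
case eJ: (e \in J) => /=.
  by have /existsPn/(_ e) := crossed_component t (subxx J); rewrite eJ.
rewrite negb_and /covers_set.
case e1: (_.1 \in component J t); first by rewrite (out _ e1).
by case e2: (_.2 \in component J t); rewrite ?(out _ e2) ?andbF ?orbT.
Qed.

Lemma halo_core J s A t : A \in halo (residual F J) (component J s) ->
  core J t -> component J t \subset A -> component J t = component J s.
Proof.
rewrite inE => /andP[_ /forall_inP H] ct sub.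
by apply/eqP; apply: implyP sub; exact: H (core_cores ct).
Qed.

(** A halo set left uncovered would contain a core of the residual family of [J :|: avoid J s], and
    that core contains an old one. By the halo condition the old one is the component of [s], so [s]
    would still be a core. *)
Lemma restricted_avoid J s : core J s -> ~~ core (J :|: avoid J s) s ->
  restricted_cover (residual F J) (component J s) (avoid J s).
Proof.
move=> cs ncs; apply/andP; split; last first.
  apply/forall_inP => e; rewrite inE => /andP[e1 e2]; apply/forall_inP => D.
  case/coresP => t ct ->; apply/implyP => ne.
  suff H v : (v \in component J s) || ~~ core J v -> v \notin component J t.
    by rewrite !H.
  apply: contraTN => vt; rewrite negb_or negbK; apply/andP; split.
    by apply: contra ne => vs; apply/eqP; exact: component_eq vt vs.
  by move: vt; rewrite in_component => /core_conn <-.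
apply/forall_inP => A Ah; apply: contraT => nA.
have AR : A \in residual F J by move: Ah; rewrite inE => /andP[].
have AR' : A \in residual F (J :|: avoid J s).
  move: AR; rewrite !in_residual => /andP[-> nJ] /=.
  apply/existsPn => e; rewrite in_setU negb_and negb_or.
  move/existsPn: nA => /(_ e); move/existsPn: nJ => /(_ e); rewrite !negb_and.
  by case: (e \in J); case: (e \in avoid J s); case: (covers_set e A) => /=.
have [t [tA ct sub]] := residual_core AR'.
have tR : component (J :|: avoid J s) t \in residual F J.
  by apply: (residual_sub (subsetUl J (avoid J s))); case/andP: ct.
have [w [wt cw subw]] := residual_core tR.
have Ew := halo_core Ah cw (subset_trans subw sub).
have st : conn (J :|: avoid J s) t s by rewrite -in_component (subsetP subw) // Ew mem_component.
by rewrite -(core_conn st) ct in ncs.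
Qed.

(** If [s] is still a core, its component in [J :|: K] is a member of the old residual family that
    [K] does not cross. Since [K] covers the halo, this member lies outside the halo and contains
    another core. *)
Lemma restricted_not_core J s K : restricted_cover (residual F J) (component J s) K ->
  core (J :|: K) s ->
    exists2 t, core J t & (t \in component (J :|: K) s) && (t \notin component J s).
Proof.
move=> /andP[/forall_inP cov _] cs.
set Y := component (J :|: K) s.
have YR : Y \in residual F J by apply: (residual_sub (subsetUl J K)); case/andP: cs.
have : Y \notin halo (residual F J) (component J s).
  apply: contraT; rewrite negbK => /cov cY.
  by have := crossed_component s (subsetUr J K); rewrite /crossed cY.
rewrite inE YR /= => /forall_inPn[D] /coresP[t ct ->].
rewrite negb_imply => /andP[sub ne]; exists t => //.
rewrite (subsetP sub) ?mem_component //=; apply: contra ne => ts.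
by apply/eqP; exact: component_eq (mem_component _ _) ts.
Qed.

Lemma good_restricted J s K : core J s ->
  restricted_cover (residual F J) (component J s) K -> good J (J :|: K).
Proof.
move=> cs rK; apply/existsP; exists s; rewrite cs /=.
case csK: (core (J :|: K) s) => //=.
have [t ct /andP[tK ts]] := restricted_not_core rK csK.
by apply/existsP; exists t; rewrite ct tK ts.
Qed.

(** [K] lies in [avoid J s], and adding [avoid J s] leaves the components of all other cores intact.
    So if [s] stayed a core, its enlarged component would be a halo set not crossed by [K]. *)
Lemma restricted_coverable J s K : core J s ->
  restricted_cover (residual F J) (component J s) K -> coverable J s.
Proof.
move=> cs rK; rewrite /coverable cs /=; apply/negP => csE.
have KE : K \subset avoid J s.
  apply/subsetP => e eK; rewrite inE; case/andP: rK => _ /forall_inP/(_ _ eK)/forall_inP H.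
  suff D v : (v == (ends I e).1) || (v == (ends I e).2) ->
      (v \in component J s) || ~~ core J v by rewrite !D ?eqxx ?orbT.
  move=> ve; case cv: (core J v); rewrite ?orbT // orbF; apply: contraT => vs.
  have := H _ (core_cores cv); have -> /= : component J v != component J s.
    by apply: contra vs => /eqP <-; exact: mem_component.
  by case/orP: ve => /eqP <-; rewrite mem_component ?andbF.
set Y := component (J :|: avoid J s) s.
have YR : Y \in residual F J by apply: (residual_sub (subsetUl J (avoid J s))); case/andP: csE.
have Yh : Y \in halo (residual F J) (component J s).
  rewrite inE YR; apply/forall_inP => D /coresP[t ct ->]; apply/implyP => sub.
  apply: contraT => ne.
  have ts : t \notin component J s.
    by apply: contra ne => ts; apply/eqP; exact: component_eq (mem_component _ _) ts.
  have tY : t \in Y by rewrite (subsetP sub) ?mem_component.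
  have : s \in component (J :|: avoid J s) t.
    by rewrite (component_eq (mem_component _ t) tY) mem_component.
  by rewrite component_avoid // in_component conn_sym -in_component (negbTE ts).
have [/forall_inP/(_ _ Yh)/exists_inP[e eK cY] _] := andP rK.
have /existsPn/(_ e) := crossed_component s (subsetUr J (avoid J s)).
by rewrite (subsetP KE) // cY.
Qed.

End Cores.

(** * Shortest paths and cheap candidates *)

Section Labels.
Variable I : instance.
Implicit Types (J K : {set edge I}) (e : edge I) (s t u v : node I).
Implicit Type L : {ffun node I -> {set edge I}}.

Definition relax L (b : {set edge I}) e u v' v : {set edge I} :=
  if (v == v') && (total_cost (e |: L u) <= total_cost b) then e |: L u else b.

(** A round of Bellman-Ford whose labels are edge sets instead of numbers. Labels contain [J], so
    edges of [J] are free, and a label is itself a candidate for the greedy step. *)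
Definition bf_step L : {ffun node I -> {set edge I}} :=
  [ffun v => foldl (fun b e => relax L (relax L b e (ends I e).1 (ends I e).2 v)
                                 e (ends I e).2 (ends I e).1 v)
               (L v) (enum (edge I))].

(** The full edge set plays the part of infinity: no label costs more, and it connects [s] to
    everything reachable. *)
Definition bf_init J s : {ffun node I -> {set edge I}} :=
  [ffun v => if v == s then J else setT].

Definition labels J s := iter (nedges I) bf_step (bf_init J s).

Hypothesis cost_ge0 : forall e, 0 <= cost I e.

Lemma total_cost_ge0 J : 0 <= total_cost J.
Proof. exact: sumr_ge0. Qed.

Lemma total_cost_sub J K : J \subset K -> total_cost J <= total_cost K.
Proof.
move=> JK; rewrite /total_cost [leRHS](big_setID J) /= (setIidPr JK) lerDl.
exact: sumr_ge0.
Qed.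

Lemma total_costU J K : total_cost (J :|: K) <= total_cost J + total_cost K.
Proof.
rewrite /total_cost (big_setID J) /= setUK setDUl setDv set0U lerD2l.
exact: (total_cost_sub (subsetDl K J)).
Qed.

(** The source of the triangle inequality for distances: [J] is contained in both labels and is
    counted only once in their union. *)
Lemma total_cost_submod J K K' : J \subset K -> J \subset K' ->
  total_cost (K :|: K') + total_cost J <= total_cost K + total_cost K'.
Proof.
move=> JK JK'; rewrite {1}/total_cost (big_setID K) /= setUK setDUl setDv set0U.
rewrite -/(total_cost K) -/(total_cost (K' :\: K)) -addrA lerD2l addrC.
rewrite [leRHS]/total_cost (big_setID K) /= lerD2r.
by apply: total_cost_sub; rewrite subsetI JK' JK.
Qed.

Lemma total_cost1 e K : total_cost (e |: K) <= cost I e + total_cost K.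
Proof.
by apply: le_trans (total_costU _ _) _; rewrite /total_cost big_set1.
Qed.

Lemma bf_step_le L v : total_cost (bf_step L v) <= total_cost (L v).
Proof.
rewrite ffunE; elim/last_ind: (enum _) => // l e IH; rewrite -cats1 foldl_cat /=.
have relax_le b f u v' w : total_cost (relax L b f u v' w) <= total_cost b.
  by rewrite /relax; case: ifP => // /andP[].
by apply: le_trans (relax_le _ _ _ _ _) (le_trans (relax_le _ _ _ _ _) IH).
Qed.

Lemma bf_step_joins L e u v : joins e u v ->
  total_cost (bf_step L v) <= total_cost (e |: L u).
Proof.
move=> j; rewrite ffunE; have : e \in enum (edge I) by rewrite mem_enum.
have relax_le b f w v' x : total_cost (relax L b f w v' x) <= total_cost b.
  by rewrite /relax; case: ifP => // /andP[].
have relax_eq b f w x : total_cost (relax L b f w x x) <= total_cost (f |: L w).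
  by rewrite /relax eqxx /=; case: ifP => // /negbT; rewrite -ltNge => /ltW.
elim/last_ind: (enum _) => // l f IH; rewrite -cats1 foldl_cat mem_cat /= inE.
case/orP => [/IH le|/eqP <-].
  by apply: le_trans (relax_le _ _ _ _ _) (le_trans (relax_le _ _ _ _ _) le).
case: (joins_endsP j) => -[-> ->] //.
exact: le_trans (relax_le _ _ _ _ _) (relax_eq _ _ _ _).
Qed.

Lemma bf_step_inv (P : node I -> {set edge I} -> Prop) L :
  (forall v, P v (L v)) ->
  (forall e u v, joins e u v -> P v (e |: L u)) ->
  forall v, P v (bf_step L v).
Proof.
move=> PL Pj v; rewrite ffunE.
elim/last_ind: (enum _) => // l e IH; rewrite -cats1 foldl_cat /=.
have relaxP b f u v' : joins f u v' -> P v b -> P v (relax L b f u v' v).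
  by move=> j Pb; rewrite /relax; case: ifP => // /andP[/eqP -> _]; exact: Pj.
apply: (relaxP); first by rewrite joins_sym joins_ends.
by apply: (relaxP) => //; exact: joins_ends.
Qed.

Lemma iter_bf_sound k J s v : let L := iter k bf_step (bf_init J s) in
  J \subset L v /\ (conn setT s v -> conn (L v) s v).
Proof.
pose P v (K : {set edge I}) := J \subset K /\ (conn setT s v -> conn K s v).
move=> /=; elim: k v => [|k IH] v.
  rewrite ffunE; case: (eqVneq v s) => [->|_]; last by split=> //; exact: subsetT.
  by split=> // _; exact: conn_refl.
apply: (@bf_step_inv P) => // e u w j; have [sub c] := IH u.
split=> [|d]; first exact: subset_trans sub (subsetUr _ _).
apply: (@conn_trans _ _ u).
  apply: conn_sub (subsetUr _ _) (c _); apply: conn_trans d _.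
  by rewrite conn_sym; apply: conn_joins j; rewrite inE.
by apply: conn_joins j; rewrite !inE eqxx.
Qed.

Lemma labels_sub J s v : J \subset labels J s v.
Proof. by case: (iter_bf_sound (nedges I) J s v). Qed.

Lemma labels_conn J s v : conn setT s v -> conn (labels J s v) s v.
Proof. by case: (iter_bf_sound (nedges I) J s v). Qed.

(* The number of rounds bounds the number of edges of a path, and by
   [conn_last] a path uses each edge of [K] at most once. *)
Lemma labels_le J K s v : conn K s v ->
  total_cost (labels J s v) <= total_cost (J :|: K).
Proof.
suff H k K' w : (#|K'| <= k)%N -> conn K' s w ->
    total_cost (iter k bf_step (bf_init J s) w) <= total_cost (J :|: K').
  by apply: H; rewrite -[X in (_ <= X)%N]card_ord max_card.
elim: k K' w => [|k IH] K' w cK c.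
  move: cK; rewrite leqn0 cards_eq0 => /eqP K0; rewrite K0 in c *.
  have <- : s = w.
    apply/eqP; apply: contraT => sw; have [e [u [eK _ _]]] := conn_first c sw.
    by rewrite inE in eK.
  by rewrite /= ffunE eqxx setU0.
rewrite iterS; case: (eqVneq s w) => [<-|sw].
  apply: le_trans (total_cost_sub (subsetUl J K')).
  apply: le_trans (bf_step_le _ _) _; elim: k {IH cK} => [|k IH].
    by rewrite ffunE eqxx.
  by rewrite iterS; apply: le_trans (bf_step_le _ _) IH.
have [e [u [eK j c']]] := conn_last c sw.
apply: le_trans (bf_step_joins _ j) _.
set L := iter _ _ _.
have Lu : total_cost (L u) <= total_cost (J :|: (K' :\ e)).
  by apply: IH => //; move: cK; rewrite (cardsD1 e) eK.
have JL : J \subset L u by case: (iter_bf_sound k J s u).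
case: (boolP (e \in J)) => eJ.
  rewrite (setUidPr _) ?sub1set ?(subsetP JL) //; apply: le_trans Lu _.
  by apply: total_cost_sub; rewrite setUS ?subsetDl.
have -> : total_cost (J :|: K') = cost I e + total_cost (J :|: (K' :\ e)).
  rewrite /total_cost (big_setD1 e) /=; last by rewrite inE eK orbT.
  congr (_ + _); apply: eq_bigl => f; rewrite !inE.
  by case: eqP => //= ->; rewrite (negbTE eJ).
by apply: le_trans (total_cost1 _ _) _; rewrite lerD2l.
Qed.

End Labels.

(* A path in [K] from [s] to [v] uses each edge at most once. *)
Lemma potential_le (I : instance) (K : {set edge I}) (p : node I -> rat) s v :
  conn K s v -> p s - p v <= \sum_(e in K) `|p (ends I e).1 - p (ends I e).2|.
Proof.
have [k] := ubnP #|K|; elim: k K s => // k IH K s cK c.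
case: (eqVneq s v) => [->|sv]; first by rewrite subrr sumr_ge0.
have [e [u [eK j c']]] := conn_first c sv.
have lt : (#|K :\ e| < k)%N by move: cK; rewrite (cardsD1 e) eK.
rewrite (big_setD1 e) //=; have := IH _ _ lt c'.
case: (joins_endsP j) => -[-> ->]; set S := \sum_(_ in _) _; move=> le.
  have := ler_norm (p s - p u); lra.
by rewrite distrC; have := ler_norm (p s - p u); lra.
Qed.

(** [a s] and [b s] will be the depths of the two ends of one edge in the ball around [s]. Balls are
    disjoint, so each is positive for at most one [s] and at most two terms survive; the last
    hypothesis handles two different balls. *)
Lemma sum_le1 (T : finType) (R : {set T}) (a b : T -> rat) (c : rat) :
  (forall s, s \in R -> 0 <= a s) -> (forall s, s \in R -> 0 <= b s) -> 0 <= c ->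
  (forall s t, s \in R -> t \in R -> 0 < a s -> 0 < a t -> s = t) ->
  (forall s t, s \in R -> t \in R -> 0 < b s -> 0 < b t -> s = t) ->
  (forall s, s \in R -> `|a s - b s| <= c) ->
  (forall s t, s \in R -> t \in R -> s != t -> 0 < a s -> 0 < b t -> a s + b t <= c) ->
  \sum_(s in R) `|a s - b s| <= c.
Proof.
move=> a0 b0 c0 ua ub ab1 ab2.
have zero (f : T -> rat) s : (forall s, s \in R -> 0 <= f s) -> s \in R ->
    (0 < f s) = false -> f s = 0.
  by move=> f0 sR /negbT; rewrite -leNgt => le; apply/eqP; rewrite eq_le le f0.
have one s0 : s0 \in R -> (forall s, s \in R -> s != s0 -> a s = 0 /\ b s = 0) ->
    \sum_(s in R) `|a s - b s| <= c.
  move=> s0R H; rewrite (big_setD1 s0) //= big1 ?addr0; first exact: ab1.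
  by move=> s; rewrite !inE => /andP[ne sR]; have [-> ->] := H _ sR ne; rewrite subrr normr0.
have unique (f : T -> rat) s0 s : (forall s, s \in R -> 0 <= f s) ->
    (forall s t, s \in R -> t \in R -> 0 < f s -> 0 < f t -> s = t) ->
    s0 \in R -> 0 < f s0 -> s \in R -> s != s0 -> f s = 0.
  move=> f0 uf s0R p0 sR ne; apply: zero => //; apply: contraNF ne => p1.
  by apply/eqP; exact: uf.
case: (pickP (fun s => (s \in R) && (0 < a s))) => [s0 /andP[s0R as0]|noa];
case: (pickP (fun s => (s \in R) && (0 < b s))) => [t0 /andP[t0R bt0]|nob].
- case: (eqVneq s0 t0) => [E|ne].
    apply: (one _ s0R) => s sR ns; split; first exact: (unique a s0).
    by apply: (unique b t0) => //; rewrite -E.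
  rewrite (big_setD1 s0) //= (big_setD1 t0) /=; last by rewrite !inE eq_sym ne.
  rewrite big1 => [|s]; last first.
    rewrite !inE => /and3P[st ss sR].
    by rewrite (unique a s0) // (unique b t0) // subrr normr0.
  rewrite (unique b t0 s0) // (unique a s0 t0) // 1?eq_sym //.
  by rewrite subr0 sub0r normrN !ger0_norm ?addr0 ?a0 ?b0 //; exact: ab2.
- apply: (one _ s0R) => s sR ns; split; first exact: (unique a s0).
  by apply: zero => //; have := nob s; rewrite sR.
- apply: (one _ t0R) => s sR ns; split; last exact: (unique b t0).
  by apply: zero => //; have := noa s; rewrite sR.
rewrite big1 // => s sR.
have -> : a s = 0 by apply: zero => //; have := noa s; rewrite sR.
have -> : b s = 0 by apply: zero => //; have := nob s; rewrite sR.
by rewrite subrr normr0.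
Qed.

(** * Ball packing around the cores *)

Section Charging.
Variables (I : instance) (F : {set {set node I}}).
Hypothesis cost_ge0 : forall e : edge I, 0 <= cost I e.
Hypothesis F0 : set0 \notin F.
Hypothesis compF : disjointness_compliable F.
Variables (J K : {set edge I}).
Hypothesis covK : covers K F.

Let H := J :|: K.
(** One representative per core, which turns sums over cores into sums over nodes. *)
Let R := [set s | core F J s && (fingraph.root (adj J) s == s)].

Let conn_H u v : conn J u v -> conn H u v.
Proof. exact/conn_sub/subsetUl. Qed.

Let root_conn s : conn J s (fingraph.root (adj J) s).
Proof. exact: connect_root. Qed.

Let R_eq s t : s \in R -> t \in R -> conn J s t -> s = t.
Proof.
rewrite !inE => /andP[_ /eqP Es] /andP[_ /eqP Et] c.
by rewrite -Es -Et; apply/(fingraph.rootP (sym_connect_sym (@adj_sym _ J))).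
Qed.

Let root_R s : core F J s -> fingraph.root (adj J) s \in R.
Proof.
move=> cs; rewrite inE -(core_conn F (root_conn s)) cs /=.
by rewrite root_root //; exact: (sym_connect_sym (@adj_sym _ J)).
Qed.

Lemma card_core_roots : #|R| = #|cores (residual F J)|.
Proof.
have inj : {in R &, injective (component J)}.
  move=> s t sR tR E; apply: R_eq => //.
  by rewrite -in_component E mem_component.
rewrite -(card_in_imset inj); congr #|pred_of_set _|; apply/setP => C.
apply/imsetP/(coresP F0 compF) => [[s sR ->]|[s cs ->]].
  by exists s => //; move: sR; rewrite inE => /andP[].
by exists (fingraph.root (adj J) s); [exact: root_R | exact/eq_component/root_conn].
Qed.

Definition single s := [forall t in R, conn H s t ==> (t == s)].

Definition piece s : {set edge I} := [set e in K | conn H s (ends I e).1].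

Let conn_piece s e : e \in K -> conn H s (ends I e).1 = conn H s (ends I e).2.
Proof.
move=> eK; have c : conn H (ends I e).1 (ends I e).2.
  by apply: conn_ends; rewrite inE eK orbT.
by apply/idP/idP => [/conn_trans/(_ c)//|d]; apply: conn_trans d _; rewrite conn_sym.
Qed.

(** For a halo set [A] and the component [X] of [s] in [H], the set [A :&: X] is in the family:
    otherwise [A :\: X] would contain a core, which by the halo condition contains [s], yet [s] is
    in [X]. An edge of [K] covering [A :&: X] does not leave [X], so it belongs to the piece and
    covers [A]. *)
Lemma piece_restricted s : s \in R -> single s ->
  restricted_cover (residual F J) (component J s) (piece s).
Proof.
move=> sR /forall_inP sing; have cs : core F J s by move: sR; rewrite inE => /andP[].
have only t : core F J t -> conn H s t -> conn J s t.
  move=> ct c; have /eqP E := implyP (sing _ (root_R ct)) (conn_trans c (conn_H (root_conn t))).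
  by rewrite -E conn_sym root_conn.
apply/andP; split; last first.
  apply/forall_inP => e; rewrite inE => /andP[eK c1].
  apply/forall_inP => D /(coresP F0 compF)[t ct ->]; apply/implyP => ne.
  have out v : conn H s v -> v \notin component J t.
    move=> c; apply: contra ne => vt; apply/eqP/esym/eq_component; apply: only => //.
    by apply: conn_trans c (conn_H _); rewrite conn_sym -in_component.
  by rewrite !out // -conn_piece.
apply/forall_inP => A Ah; have := Ah; rewrite inE in_residual => /andP[/andP[AF nA] _].
pose X := component H s.
have nX : ~~ crossed J X by apply: crossed_component; exact: subsetUl.
have AXF : A :&: X \in F.
  have [//|DF] := compF (subsetIl A X) AF.
  have DR : A :\: (A :&: X) \in residual F J.
    by rewrite in_residual DF setDIr setDv set0U uncrossedD.
  have [t [tD ct sub]] := residual_core F0 compF DR.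
  have Et := halo_core F0 compF Ah ct (subset_trans sub (subsetDl _ _)).
  have : s \in A :\: (A :&: X) by rewrite (subsetP sub) // Et mem_component.
  rewrite !inE negb_and => /andP[/orP[/negbTE -> //|]].
  by rewrite in_component conn_refl.
have [e eK cov] := exists_inP (forall_inP covK _ AXF).
move: cov; rewrite /covers_set !inE !in_component -(conn_piece _ eK).
case c1: (conn H s _); rewrite ?andbF // !andbT => cov.
by apply/exists_inP; exists e; rewrite ?inE ?eK ?c1.
Qed.

(** The distance from [s] to [v] after contraction of the components of [J], for [v] reachable from
    [s]. *)
Definition delta s v : rat := total_cost (labels J s v) - total_cost J.

Definition marginal e : rat := if e \in J then 0 else cost I e.

Let delta_ge0 s v : 0 <= delta s v.
Proof. by rewrite subr_ge0 total_cost_sub // labels_sub. Qed.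

Let delta_edge s e u v : conn H s u -> joins e u v -> e \in H ->
  delta s v <= delta s u + marginal e.
Proof.
move=> c j eH; have cu : conn (labels J s u) s u.
  by apply: labels_conn; exact: conn_sub (subsetT _) c.
have cv : conn (e |: labels J s u) s v.
  apply: (@conn_trans _ _ u); first exact: conn_sub (subsetUr _ _) cu.
  by apply: conn_joins j; rewrite !inE eqxx.
have := labels_le cost_ge0 J cv.
rewrite (setUidPr (subset_trans (labels_sub J s u) (subsetUr _ _))) /delta /marginal.
case: ifP => eJ.
  rewrite (setUidPr _); first by lra.
  by rewrite sub1set (subsetP (labels_sub J s u)).
have := total_cost1 cost_ge0 e (labels J s u); lra.
Qed.

Let delta_triangle s t u : conn H s u -> conn H t u ->
  delta s t <= delta s u + delta t u.
Proof.
move=> cs ct.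
have cu : conn (labels J s u) s u by apply/labels_conn/(conn_sub (subsetT _) cs).
have cv : conn (labels J t u) t u by apply/labels_conn/(conn_sub (subsetT _) ct).
have c : conn (labels J s u :|: labels J t u) s t.
  apply: (@conn_trans _ _ u); first exact: conn_sub (subsetUl _ _) cu.
  by rewrite conn_sym; exact: conn_sub (subsetUr _ _) cv.
have := labels_le cost_ge0 J c.
rewrite (setUidPr (subset_trans (labels_sub J s u) (subsetUl _ _))) /delta.
have := total_cost_submod cost_ge0 (labels_sub J s u) (labels_sub J t u); lra.
Qed.

Let delta_refl s : delta s s = 0.
Proof.
apply/eqP; rewrite eq_le delta_ge0 andbT /delta subr_le0.
by have := labels_le cost_ge0 J (conn_refl J s); rewrite setUid.
Qed.

(* Ball packing: balls of radius [r] around the cores are disjoint, and an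
   edge is charged for the part of it inside each ball; a core alone in its
   component of [H] instead owns all edges of that component. *)
Lemma charging (r : rat) : 0 <= r ->
  (forall s, s \in R -> single s -> r <= total_cost (piece s)) ->
  (forall s t, s \in R -> t \in R -> s != t -> conn H s t -> r *+ 2 <= delta s t) ->
  r *+ #|R| <= total_cost K.
Proof.
move=> r0 r_single r_pair.
(* The depth of [v] in the ball of radius [r] around [s]. *)
pose p (s v : node I) : rat := if conn H s v then Num.max (0 : rat) (r - delta s v) else 0.
have p0 s v : 0 <= p s v by rewrite /p; case: ifP => // _; rewrite le_max lexx.
have p_pos s v : 0 < p s v -> conn H s v /\ p s v = r - delta s v.
  rewrite /p; case: ifP => [c|]; last by rewrite ltxx.
  by rewrite /Num.max; case: ifP => //; rewrite ltxx.
have p_edge s e : e \in H -> `|p s (ends I e).1 - p s (ends I e).2| <=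
    marginal e.
  move=> eH; rewrite /p; have c12 := conn_ends eH.
  have -> : conn H s (ends I e).2 = conn H s (ends I e).1.
    by apply/idP/idP => c; [rewrite conn_sym in c12|]; exact: conn_trans c c12.
  have c0 : 0 <= marginal e by rewrite /marginal; case: ifP.
  case: ifP => [c|_]; last by rewrite subrr normr0.
  have d1 := delta_edge c (joins_ends e) eH.
  have j' := joins_ends e; rewrite joins_sym in j'.
  have d2 := delta_edge (conn_trans c c12) j' eH.
  rewrite ler_norml !maxEle.
  case: (lerP 0 (r - delta s (ends I e).1)); case: (lerP 0 (r - delta s (ends I e).2)) => *;
    by apply/andP; split; lra.
have p_uniq s t v : s \in R -> t \in R -> 0 < p s v -> 0 < p t v -> s = t.
  move=> sR tR /[dup] ps /p_pos[cs Es] /[dup] pt /p_pos[ct Et]; apply/eqP.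
  apply: contraT => st; have := delta_triangle cs ct.
  have cst : conn H s t by apply: conn_trans cs _; rewrite conn_sym.
  by have := r_pair _ _ sR tR st cst; rewrite mulr2n; lra.
(* The centres are at distance at least [2 r], so the parts of an edge inside two different balls do
   not overlap. *)
have p_cross s t e : e \in K -> s \in R -> t \in R -> s != t ->
    0 < p s (ends I e).1 -> 0 < p t (ends I e).2 ->
    p s (ends I e).1 + p t (ends I e).2 <= cost I e.
  move=> eK sR tR st /p_pos[cs Es] /p_pos[ct Et].
  have eH : e \in H by rewrite inE eK orbT.
  have cs2 := conn_trans cs (conn_ends eH).
  have cst : conn H s t by apply: conn_trans cs2 _; rewrite conn_sym.
  have := delta_triangle cs2 ct; have := delta_edge cs (joins_ends e) eH.
  have := r_pair _ _ sR tR st cst; rewrite mulr2n Es Et /marginal.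
  by case: ifP; have := cost_ge0 e; lra.
pose ch s e : rat := if single s then (if conn H s (ends I e).1 then cost I e else 0)
                     else `|p s (ends I e).1 - p s (ends I e).2|.
(* A core that is not single has another core in its component of [H], at distance at least [2 r],
   where its own depth is 0. The depth falls from [r] to 0 along [H], and edges of [J], having
   length 0, contribute nothing. *)
have ch_lb s : s \in R -> r <= \sum_(e in K) ch s e.
  move=> sR; rewrite /ch; case sing: (single s).
    rewrite -big_mkcondr; apply: le_trans (r_single _ sR sing) _.
    by rewrite /total_cost le_eqVlt; apply/orP; left; apply/eqP/eq_bigl => e; rewrite inE.
  move/negbT: sing => /forall_inPn[t tR]; rewrite negb_imply => /andP[c ts].
  have := potential_le (p s) c.
  have -> : p s s = r by rewrite /p conn_refl delta_refl subr0 maxEle r0.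
  have -> : p s t = 0.
    rewrite /p c maxEle; have := r_pair _ _ sR tR; rewrite eq_sym ts => /(_ isT c).
    by rewrite mulr2n; case: (lerP 0 (r - delta s t)) => // *; lra.
  rewrite subr0 => le; apply: le_trans le _.
  rewrite (big_setID K) /= (setIidPr (subsetUr J K)) gerDl sumr_le0 // => e.
  rewrite !inE => /andP[eK /orP[eJ|eK']]; last by rewrite eK' in eK.
  by have := p_edge s e; rewrite /marginal !inE eJ /=; exact.
(* An edge in the piece of a single core is charged by no other core, since the others lie in other
   components of [H]. All remaining edges fall under [sum_le1]. *)
have ch_ub e : e \in K -> \sum_(s in R) ch s e <= cost I e.
  move=> eK; have eH : e \in H by rewrite inE eK orbT.
  have p_le s : `|p s (ends I e).1 - p s (ends I e).2| <= cost I e.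
    by apply: le_trans (p_edge s e eH) _; rewrite /marginal; case: ifP.
  case: (pickP (fun s => [&& s \in R, single s & conn H s (ends I e).1])) => [s0|nos].
    case/and3P => s0R sing c0; rewrite (big_setD1 s0) //= big1 ?addr0.
      by rewrite /ch sing c0.
    move=> s; rewrite in_setD1 => /andP[ne sR].
    have nc : conn H s (ends I e).1 = false.
      apply: contraNF ne => c; apply: (implyP (forall_inP sing _ sR)).
      by apply: conn_trans c0 _; rewrite conn_sym.
    rewrite /ch nc; case: ifP => // _.
    by rewrite /p -(conn_piece s eK) nc subrr normr0.
  have ch_le s : s \in R -> ch s e <= `|p s (ends I e).1 - p s (ends I e).2|.
    move=> sR; rewrite /ch; case: ifP => // sing.
    by have := nos s; rewrite sR sing /= => ->.
  apply: le_trans (ler_sum _ ch_le) _.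
  apply: (@sum_le1 _ R (fun s => p s (ends I e).1) (fun s => p s (ends I e).2)) => //.
  - by move=> s t sR tR; exact: p_uniq.
  - by move=> s t sR tR; exact: p_uniq.
  by move=> s t sR tR; exact: p_cross.
rewrite -sumr_const; apply: le_trans (ler_sum _ ch_lb) _.
by rewrite exchange_big /=; exact: ler_sum.
Qed.

(** The radius given to [charging] is the largest one that its hypotheses allow, and a minimiser
    that determines it is the candidate. The fact [1 < nu] is recorded so that the factor 2 never
    meets the last core. *)
Lemma cheap_candidate : [exists s, core F J s] ->
  let nu := #|cores (residual F J)| in
  (exists s C, [/\ core F J s, restricted_cover (residual F J) (component J s) C &
     total_cost C *+ nu <= total_cost K]) \/
  (exists s t, [/\ core F J s, core F J t, t \notin component J s, conn H s t &
     (1 < nu)%N /\ (total_cost (labels J s t) - total_cost J) *+ nu <= total_cost K *+ 2]).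
Proof.
move=> /existsP[s0 /root_R s0R] /=; rewrite -card_core_roots.
(* A diagonal pair stands for a single core, any other pair for a path between two cores. *)
pose P (x : node I * node I) := [&& x.1 \in R, x.2 \in R, conn H x.1 x.2 &
  (x.1 == x.2) ==> single x.1].
pose f (x : node I * node I) : rat :=
  if x.1 == x.2 then total_cost (piece x.1) else delta x.1 x.2 / 2.
set s1 := fingraph.root _ _ in s0R.
have [x0 Px0] : exists x, P x.
  case sing: (single s1); first by exists (s1, s1); rewrite /P /= s0R conn_refl sing implybT.
  move/negbT: sing => /forall_inPn[t tR]; rewrite negb_imply => /andP[c ts].
  by exists (s1, t); rewrite /P /= s0R tR c eq_sym (negbTE ts).
case: (Order.TotalTheory.arg_minP f Px0) => -[s t] /= /and4P[/= sR tR c sing] min.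
have f0 : 0 <= f (s, t).
  by rewrite /f; case: ifP => _; [exact: total_cost_ge0 | rewrite divr_ge0].
have le : f (s, t) *+ #|R| <= total_cost K.
  apply: charging => // [u uR su|u v uR vR uv cuv].
    have := min (u, u); rewrite /P /= uR conn_refl su implybT => /(_ isT).
    by rewrite {2}/f eqxx.
  have := min (u, v); rewrite /P /= uR vR cuv (negbTE uv) => /(_ isT).
  rewrite {2}/f /= (negbTE uv) mulr2n => le; have {}le : f (s, t) <= delta u v / 2 := le.
  by move: (f (s, t)) (delta u v) le => x y le; lra.
have cs : core F J s by move: sR; rewrite inE => /andP[].
have ct : core F J t by move: tR; rewrite inE => /andP[].
move: le sing; rewrite /f /=; case: (eqVneq s t) => [_|st] le /= sing.
  by left; exists s, (piece s); split=> //; exact: piece_restricted.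
right; exists s, t; split=> //.
- by rewrite in_component; apply: contra st => d; apply/eqP/R_eq.
split.
  by rewrite (cardsD1 s) sR (cardsD1 t) in_setD1 tR eq_sym st.
have -> : (total_cost (labels J s t) - total_cost J) *+ #|R| = (delta s t / 2) *+ #|R| *+ 2.
  rewrite -/(delta s t) -mulrnA mulnC mulrnA; congr (_ *+ _).
  by rewrite mulr2n -splitr.
by rewrite lerMn2r.
Qed.

End Charging.

(** * The greedy algorithm and its approximation ratio *)

Section Prune.
Variable I : instance.
Implicit Types (J K : {set edge I}) (e : edge I) (s t u v : node I).

Definition prune_edge J e : {set edge I} :=
  if (e \in J) && ((ends I e).2 \in component (J :\ e) (ends I e).1) then J :\ e else J.

Definition prune J := foldl prune_edge J (enum (edge I)).

Lemma prune_edge_sub J e : prune_edge J e \subset J.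
Proof. by rewrite /prune_edge; case: ifP => // _; exact: subsetDl. Qed.

Lemma foldl_prune_sub J l : foldl prune_edge J l \subset J.
Proof.
elim: l J => //= e l IH J; exact: subset_trans (IH _) (prune_edge_sub J e).
Qed.

Lemma prune_conn J u v : conn J u v -> conn (prune J) u v.
Proof.
rewrite /prune; elim: (enum _) J => //= e l IH J c; apply: IH.
rewrite /prune_edge; case: ifP => // /andP[eJ]; rewrite in_component => ce.
apply: connect_sub c => {}u {}v /existsP[f /andP[fJ j]].
case: (eqVneq f e) j => [->|fe] j; last by apply: conn_joins j; rewrite !inE fe.
case: (joins_endsP j) => -[<- <-] //; have := ce; rewrite conn_sym; exact.
Qed.

Lemma prune_covers J (F : {set {set node I}}) : covers J F -> covers (prune J) F.
Proof.
move=> /forall_inP H; apply/forall_inP => A /H.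
apply: contraLR => /uncrossedP nA; apply/uncrossedP => u v /prune_conn.
exact: nA.
Qed.

(** One pass suffices: an edge that is kept is a bridge when it is examined, and later deletions
    cannot reconnect its ends. *)
Lemma prune_bridge J e : e \in prune J ->
  ~~ conn (prune J :\ e) (ends I e).1 (ends I e).2.
Proof.
rewrite /prune; have : e \in enum (edge I) by rewrite mem_enum.
case/splitPr => l1 l2; rewrite foldl_cat /=.
set J1 := foldl _ _ l1; set J2 := prune_edge J1 e; set T := foldl _ _ l2.
have T2 : T \subset J2 by exact: foldl_prune_sub.
move=> eT; have eJ2 : e \in J2 by exact: (subsetP T2).
move: eJ2 T2; rewrite /J2 /prune_edge; case: ifP => [|/negbT]; first by rewrite !inE eqxx.
move=> + eJ1 T1; rewrite eJ1 in_component /=; apply: contra.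
by apply: conn_sub; exact: setSD.
Qed.

Lemma conn_walk (T : {set edge I}) (x y : node I * edge I) w :
  path (fun a b => joins a.2 a.1 b.1) x (rcons w y) ->
  all (mem T) (unzip2 (x :: w)) -> conn T x.1 y.1.
Proof.
elim: w x => [|z w IH] x /=.
  by rewrite !andbT => j xT; exact: conn_joins j.
move=> /andP[j p] /and3P[xT zT wT]; apply: conn_trans (conn_joins xT j) _.
by apply: IH p _; rewrite /= zT.
Qed.

(** The remaining edges of a cycle connect the ends of its first edge, against [prune_bridge]. A
    cycle of length one is a loop, whose ends coincide. *)
Lemma prune_forest J : forest (prune J).
Proof.
case=> [|[u e] w]; first by [].
rewrite /graph_cycle => /and4P[_ _ ue cyc]; apply/negP => /=.
move=> /andP[eT wT]; have := prune_bridge eT; case/negP.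
move: ue => /= /andP[ew _].
have sub : all (mem (prune J :\ e)) (unzip2 w).
  apply/allP => f fw; have fT : f \in prune J := allP wT _ fw.
  by rewrite /= in_setD1 fT andbT; apply: contraNneq ew => <-.
case: w cyc ew wT sub => [|[v f] w] /=; rewrite ?andbT.
  by move=> j _ _ _; case: (joins_endsP j) => -[-> ->]; exact: conn_refl.
move=> /andP[j p] _ _ sub; have c := @conn_walk _ (v, f) (u, e) w p sub.
by case: (joins_endsP j) => -[-> ->] //; rewrite conn_sym.
Qed.

End Prune.

(** * The greedy rounds *)

Section Algorithm.
Variables (I : instance) (F : {set {set node I}}).
Variable cov : {set edge I} -> {set node I} -> {set edge I}.
Implicit Types (J K b : {set edge I}) (e : edge I) (s t u v : node I).

Definition better J b K := if good F J K && (total_cost K <= total_cost b) then K else b.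

Definition scan J b s :=
  let b' := foldl (fun b v => better J b (labels J s v)) b (enum (node I)) in
  if coverable F J s then better J b' (J :|: cov J (component J s)) else b'.

(** [setT] is the initial incumbent: with nonnegative costs no candidate is dearer, and it is itself
    good whenever a cover exists and a core is left. *)
Definition augment J :=
  if [exists s, core F J s] then foldl (scan J) setT (enum (node I)) else J.

Definition greedy := prune (iter (nnodes I) augment set0).

Lemma better_le J b K : total_cost (better J b K) <= total_cost b.
Proof. by rewrite /better; case: ifP => // /andP[]. Qed.

Lemma better_good J b K : good F J K -> total_cost (better J b K) <= total_cost K.
Proof. by rewrite /better => ->; case: ifP => //= /negbT; rewrite -ltNge => /ltW. Qed.

Lemma foldl_better_le (T : eqType) J (c : T -> {set edge I}) b l :
  total_cost (foldl (fun b (x : T) => better J b (c x)) b l) <= total_cost b.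
Proof.
elim: l b => //= x l IH b; exact: le_trans (IH _) (better_le _ _ _).
Qed.

Lemma foldl_better_good (T : eqType) J (c : T -> {set edge I}) b l (x : T) :
  x \in l -> good F J (c x) ->
  total_cost (foldl (fun b (x : T) => better J b (c x)) b l) <= total_cost (c x).
Proof.
elim: l b => //= y l IH b; rewrite inE => /orP[/eqP <-|xl] g; last exact: IH.
exact: le_trans (foldl_better_le _ _ _ _) (better_good _ g).
Qed.

Lemma scan_le J b s : total_cost (scan J b s) <= total_cost b.
Proof.
rewrite /scan; case: ifP => _; last exact: foldl_better_le.
exact: le_trans (better_le _ _ _) (foldl_better_le _ _ _ _).
Qed.

Lemma scan_labels J b s v : good F J (labels J s v) ->
  total_cost (scan J b s) <= total_cost (labels J s v).
Proof.
move=> g; have le := @foldl_better_good _ J (labels J s) b _ v (mem_enum _ _) g.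
by rewrite /scan; case: ifP => // _; exact: le_trans (better_le _ _ _) le.
Qed.

Lemma scan_cov J b s : coverable F J s -> good F J (J :|: cov J (component J s)) ->
  total_cost (scan J b s) <= total_cost (J :|: cov J (component J s)).
Proof. by rewrite /scan => -> g; exact: better_good. Qed.

Lemma augment_le J s (c : {set edge I}) : [exists s, core F J s] ->
  (forall b, total_cost (scan J b s) <= total_cost c) ->
  total_cost (augment J) <= total_cost c.
Proof.
rewrite /augment => -> H; have : s \in enum (node I) by rewrite mem_enum.
have fold_le l b : total_cost (foldl (scan J) b l) <= total_cost b.
  by elim: l b => //= t l IH b; exact: le_trans (IH _) (scan_le _ _ _).
elim: (enum _) setT => //= t l IH b; rewrite inE => /orP[/eqP <-|/IH //].
exact: le_trans (fold_le _ _) (H _).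
Qed.

Lemma augment_ind (P : {set edge I} -> Prop) J : [exists s, core F J s] -> P setT ->
  (forall s v, good F J (labels J s v) -> P (labels J s v)) ->
  (forall s, good F J (J :|: cov J (component J s)) -> P (J :|: cov J (component J s))) ->
  P (augment J).
Proof.
rewrite /augment => -> PT Pl Pc.
have Pbetter b K : P b -> (good F J K -> P K) -> P (better J b K).
  by move=> Pb PK; rewrite /better; case: ifP => // /andP[/PK].
have Pscan b s : P b -> P (scan J b s).
  move=> Pb; have Pf : P (foldl (fun b v => better J b (labels J s v)) b (enum (node I))).
    by elim: (enum _) b Pb => //= v l IH b Pb; apply/IH/Pbetter => //; exact: Pl.
  by rewrite /scan; case: ifP => // _; apply: Pbetter => //; exact: Pc.
by elim: (enum _) setT PT => //= s l IH b Pb; apply/IH/Pscan.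
Qed.

Hypothesis F0 : set0 \notin F.
Hypothesis compF : disjointness_compliable F.

Lemma augment_spec K J : covers K F -> [exists s, core F J s] ->
  J \subset augment J /\ good F J (augment J).
Proof.
move=> covK exc; apply: (@augment_ind (fun b => J \subset b /\ good F J b) _ exc) => [|s v g|s g].
(* A component of the whole graph is crossed by no edge, so it cannot belong to a family that has a
   cover: every old core is destroyed. *)
- split; first exact: subsetT.
  have /existsP[s cs] := exc; apply/existsP; exists s; rewrite cs /=.
  apply/orP; left; rewrite coreE //; apply/negP => /(forall_inP covK)/exists_inP[e eK c].
  have /existsPn/(_ e) := crossed_component s (subsetT K).
  by rewrite eK c.
- by split=> //; exact: labels_sub.
by split=> //; exact: subsetUl.
Qed.

End Algorithm.

(** * The logarithmic potential *)

Section Ratio.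
Variables (R : realType) (alpha : R).
Hypothesis alpha_ge1 : 1 <= alpha.

Let beta : R := Num.max alpha 2%:R.

(** The value 0 at [n = 0] makes the jump to [n = 1] equal to [alpha], the price of the last
    core. *)
Definition rate (n : nat) : R :=
  if n is 0 then 0 else alpha + Num.max alpha 2%:R * ln n%:R.

Let beta_ge2 : 2 <= beta. Proof. by rewrite /beta le_max lexx orbT. Qed.

Lemma rate_ge0 n : 0 <= rate n.
Proof.
case: n => //= n; rewrite addr_ge0 ?mulr_ge0 ?ln_ge0 ?ler1n //.
  exact: le_trans alpha_ge1.
by apply: le_trans beta_ge2.
Qed.

Lemma rate_mono m n : (m <= n)%N -> rate m <= rate n.
Proof.
case: m n => [|m] [|n] //= mn; first exact: (rate_ge0 n.+1).
rewrite lerD2l ler_wpM2l ?ler_ln ?posrE ?ltr0n ?ler_nat //.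
by apply: le_trans beta_ge2.
Qed.

(** This is [ln (1 + x) <= x] at [x = - 1 / n], since [n - 1 = n * (1 - 1 / n)]. *)
Lemma ln_step n : (1 < n)%N -> n%:R^-1 + ln n.-1%:R <= ln n%:R :> R.
Proof.
case: n => [|[|n]] // _; rewrite [n.+2.-1]/=.
have n0 : 0 < n.+2%:R :> R by rewrite ltr0n.
have n1 : 0 < n.+1%:R :> R by rewrite ltr0n.
have -> : n.+1%:R = n.+2%:R * (1 - n.+2%:R^-1) :> R.
  by rewrite mulrBr mulr1 mulfV ?gt_eqF // -[n.+2%:R]natr1 addrK.
have inv1 : n.+2%:R^-1 < 1 :> R by rewrite invf_lt1 // ltr1n.
rewrite lnM ?posrE ?subr_gt0 // addrCA gerDl.
have := @le_ln1Dx R (- n.+2%:R^-1); rewrite ltrN2 => /(_ inv1) le.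
by rewrite -lerBrDl sub0r.
Qed.

(** The first summand bounds the cost of a round relative to [c(K)]. A round may remove several
    cores, but monotonicity reduces this to [m = n - 1]. *)
Lemma rate_step m n : (m < n)%N ->
  (if n == 1 then alpha else beta) / n%:R + rate m <= rate n.
Proof.
move=> mn; apply: (@le_trans _ _ ((if n == 1 then alpha else beta) / n%:R + rate n.-1)).
  by rewrite lerD2l rate_mono //; case: n mn.
case: n mn => [|[|n]] // _; first by rewrite /= divr1 addr0 ln1 mulr0 addr0.
rewrite [_ == 1]/= [rate _.-1]/= /rate -/beta addrCA lerD2l -mulrDr.
by rewrite ler_wpM2l ?(le_trans _ beta_ge2) //; exact: (@ln_step n.+2).
Qed.

Variables (I : instance) (F : {set {set node I}}).
Implicit Types (J K C : {set edge I}) (s : node I).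
Variable cov : {set edge I} -> {set node I} -> {set edge I}.
Hypothesis cost_ge0 : forall e : edge I, 0 <= cost I e.
Hypothesis compF : disjointness_compliable F.
Hypothesis covP : forall (J : {set edge I}) (s : node I), coverable F J s ->
  approximate (restricted_cover (residual F J) (component J s)) alpha
    (cov J (component J s)).

Lemma covers_nonempty K : covers K F -> set0 \notin F.
Proof.
move=> /forall_inP H; apply/negP => /H /exists_inP[e _].
by rewrite /covers_set !inE.
Qed.

Let potential (K J : {set edge I}) : R :=
  ratr (total_cost J) + ratr (total_cost K) * rate #|cores (residual F J)|.

Lemma augment_potential K J : covers K F -> [exists s, core F J s] ->
  potential K (augment F cov J) <= potential K J.
Proof.
move=> covK exc; have F0 := covers_nonempty covK.
have [Jsub /(good_cores F0 compF Jsub)] := augment_spec cov F0 covK exc.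
rewrite /potential; set nu := #|cores (residual F J)|; set nu' := #|_|.
move=> lt; have opt0 : 0 <= ratr (total_cost K) :> R by rewrite ler0q total_cost_ge0.
have nu0 : 0 < nu%:R :> R by rewrite ltr0n; exact: leq_trans lt.
suff le : ratr (total_cost (augment F cov J)) - ratr (total_cost J) <=
    ratr (total_cost K) * ((if nu == 1 then alpha else beta) / nu%:R) :> R.
  have := rate_step lt; move/(ler_wpM2l opt0); rewrite mulrDr; lra.
rewrite mulrA ler_pdivlMr //.
have := cheap_candidate cost_ge0 F0 compF covK exc; rewrite /= -/nu.
case=> [[s [C [cs rC]]]|[s [t [cs ct ts c [nu1]]]]].
  rewrite -(ler_rat R) rmorphMn /= -mulr_natr => leC.
  have cvb := restricted_coverable F0 compF cs rC.
  have [rcov /(_ _ rC) lecov] := covP cvb.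
  have gcov := good_restricted F0 compF cs rcov.
  have := augment_le exc (fun b => scan_cov b cvb gcov).
  move=> /le_trans/(_ (total_costU cost_ge0 _ _)); rewrite -(ler_rat R) rmorphD /=.
  move=> leaug; apply: (@le_trans _ _ (alpha * ratr (total_cost C) * nu%:R)).
    by rewrite ler_pM2r // lerBlDl; apply: le_trans leaug _; rewrite lerD2l.
  apply: (@le_trans _ _ (alpha * ratr (total_cost K))).
    by rewrite -mulrA ler_pM2l // (lt_le_trans ltr01).
  rewrite mulrC ler_wpM2l //; case: ifP => // _.
  by rewrite /beta le_max lexx.
rewrite -(ler_rat R) !rmorphMn /= rmorphB /= -mulr_natr => lel.
have gl : good F J (labels J s t).
  apply/existsP; exists s; rewrite cs /=; apply/orP; right.
  apply/existsP; exists t; rewrite ct ts andbT /= in_component.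
  exact/labels_conn/(conn_sub (subsetT _) c).
have := augment_le exc (fun b => scan_labels cov b gl); rewrite -(ler_rat R) => leaug.
apply: (@le_trans _ _ ((ratr (total_cost (labels J s t)) - ratr (total_cost J)) * nu%:R)).
  by rewrite ler_pM2r // lerD2r.
apply: le_trans lel _; rewrite -mulr_natr ler_wpM2l //.
(* Here [nu] exceeds 1, so 2 is compared with [beta] and not with [alpha], which may be smaller. *)
by case: eqP nu1 => [->|_ _].
Qed.

Lemma iter_augment K k : covers K F -> let J := iter k (augment F cov) set0 in
  (#|cores (residual F J)| <= #|cores F| - k)%N /\
  potential K J <= ratr (total_cost K) * rate #|cores F|.
Proof.
move=> covK /=; have F0 := covers_nonempty covK; elim: k => [|k [IH1 IH2]].
  by rewrite /potential /= residual_set0 subn0 /total_cost big_set0 rmorph0 add0r.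
rewrite iterS; set J := iter k _ _ in IH1 IH2 *.
case exc: [exists s, core F J s].
  have [Jsub /(good_cores F0 compF Jsub) lt] := augment_spec cov F0 covK exc.
  split; [by rewrite subnS -ltnS (leq_trans lt) // (leq_trans IH1) // leqSpred |].
  exact: le_trans (augment_potential covK exc) IH2.
have -> : augment F cov J = J by rewrite /augment exc.
split=> //; have := residual_eq0 F0 compF J; rewrite exc => /eqP ->.
rewrite (_ : cores set0 = set0) ?cards0 //; apply/setP => A; rewrite !inE.
by apply/negP => /minsetP[]; rewrite inE.
Qed.

Lemma greedy_approximate : (exists K, feasible F K) ->
  approximate (feasible F) (alpha + Num.max alpha 2%:R * ln #|cores F|%:R)
    (greedy F cov).
Proof.
move=> [K0 [_ cov0]]; have F0 := covers_nonempty cov0.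
pose J := iter (nnodes I) (augment F cov) set0.
(* Distinct cores have distinct roots. Each round removes a core, so [nnodes I] rounds leave
   none. *)
have few : (#|cores F| <= nnodes I)%N.
  rewrite -{1}(residual_set0 F) -(card_core_roots F0 compF set0).
  by rewrite -[X in (_ <= X)%N]card_ord max_card.
split.
  split; first exact: prune_forest.
  apply: prune_covers; rewrite residual0_covers residual_eq0 // -/J.
  have [le _] := iter_augment (nnodes I) cov0.
  apply/existsP => -[s cs]; move: le; rewrite -subn_eq0 in few.
  rewrite (eqP few) leqn0 cards_eq0 => /eqP E.
  by have := core_cores F0 compF cs; rewrite -/J E inE.
move=> K [_ covK]; have [_ le] := iter_augment (nnodes I) covK.
have opt0 : 0 <= ratr (total_cost K) :> R by rewrite ler0q total_cost_ge0.
apply: (@le_trans _ _ (ratr (total_cost J))).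
  by rewrite ler_rat total_cost_sub // foldl_prune_sub.
apply: (@le_trans _ _ (potential K J)).
  by rewrite /potential lerDl mulr_ge0 ?rate_ge0.
apply: le_trans le _; rewrite mulrC ler_wpM2r //.
(* Without cores the claimed ratio is [alpha], because [ln 0] is 0 by convention, and [rate 0 = 0]
   lies below it. *)
case: #|cores F| => [|n] //=; rewrite ln0 // mulr0 addr0.
exact: le_trans alpha_ge1.
Qed.

End Ratio.

(** * Running time of the greedy algorithm *)

Local Open Scope nat_scope.

Section SetPrograms.
Variables (X : Type) (i : X -> data) (n : X -> nat).
Hypothesis Hn : fp i (fun x => enc_unary (n x)).

Lemma fp_if_set b (A B : forall x, {set 'I_(n x)}) :
  fp i (fun x => enc_bool (b x)) ->
  fp i (fun x => enc_set (A x)) -> fp i (fun x => enc_set (B x)) ->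
  fp i (fun x => enc_set (if b x then A x else B x)).
Proof.
by move=> Hb HA HB; apply: fp_eq (fp_if Hb HA HB) _ => x; case: (b x).
Qed.

Lemma fp_set1 (v : forall x, 'I_(n x)) :
  fp i (fun x => enc_unary (v x)) -> fp i (fun x => enc_set [set v x]).
Proof.
move=> Hv; have H : fp i (fun x => enc_set [set w | w == v x]).
  by apply: fp_set => //; fp_enter; apply: fp_eq_ord; eassumption.
by apply: fp_eq H _ => x; congr enc_set; apply/setP => w; rewrite !inE.
Qed.

Lemma fp_setT : fp i (fun x => enc_set [set: 'I_(n x)]).
Proof.
have H : fp i (fun x => enc_set [set w : 'I_(n x) | true]).
  by apply: fp_set => //; exact: fp_true.
by apply: fp_eq H _ => x; congr enc_set; apply/setP => w; rewrite !inE.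
Qed.

Lemma fp_set0 : fp i (fun x => enc_set (set0 : {set 'I_(n x)})).
Proof.
have H : fp i (fun x => enc_set [set w : 'I_(n x) | false]).
  by apply: fp_set => //; exact: fp_false.
by apply: fp_eq H _ => x; congr enc_set; apply/setP => w; rewrite !inE.
Qed.

Lemma fp_setU (A B : forall x, {set 'I_(n x)}) :
  fp i (fun x => enc_set (A x)) -> fp i (fun x => enc_set (B x)) ->
  fp i (fun x => enc_set (A x :|: B x)).
Proof.
move=> HA HB; have H : fp i (fun x => enc_set [set w | (w \in A x) || (w \in B x)]).
  by apply: fp_set => //; fp_enter; apply: fp_or; apply: fp_in; eassumption.
by apply: fp_eq H _ => x; congr enc_set; apply/setP => w; rewrite !inE.
Qed.

Lemma fp_setD1 (A : forall x, {set 'I_(n x)}) (v : forall x, 'I_(n x)) :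
  fp i (fun x => enc_set (A x)) -> fp i (fun x => enc_unary (v x)) ->
  fp i (fun x => enc_set (A x :\ v x)).
Proof.
move=> HA Hv; have H : fp i (fun x => enc_set [set w | ~~ (w == v x) && (w \in A x)]).
  apply: fp_set => //; fp_enter; apply: fp_and; last by apply: fp_in; eassumption.
  by apply/fp_neg/fp_eq_ord; eassumption.
by apply: fp_eq H _ => x; congr enc_set; apply/setP => w; rewrite !inE.
Qed.

Variable m : X -> nat.
Hypothesis Hm : fp i (fun x => enc_unary (m x)).

(** The encoding of a subset of ['I_m] has size linear in [m], so the accumulators are bounded
    whatever [step] does. *)
Lemma fp_foldl_set (step : forall x, {set 'I_(m x)} -> 'I_(n x) -> {set 'I_(m x)})
    (b0 : forall x, {set 'I_(m x)}) :
  fp i (fun x => enc_set (b0 x)) ->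
  fp (ext2 i (fun x (v : 'I_(n x)) => enc_unary v) (fun x (A : {set 'I_(m x)}) => enc_set A))
    (fun z => enc_set (step (tag z) (tagged z).2 (tagged z).1)) ->
  fp i (fun x => enc_set (foldl (step x) (b0 x) (enum 'I_(n x)))).
Proof.
move=> Hb Hs.
apply: (@fp_foldl_ord X i n Hn (fun x => {set 'I_(m x)}) (fun x A => enc_set A) step b0) => //.
by have [g bg Hg] := bounded_enc_set Hm; exists g.
Qed.

Lemma fp_iter_set (f : forall x, {set 'I_(m x)} -> {set 'I_(m x)})
    (b0 : forall x, {set 'I_(m x)}) :
  fp i (fun x => enc_set (b0 x)) ->
  fp (ext1 i (fun x (A : {set 'I_(m x)}) => enc_set A))
    (fun z => enc_set (f (tag z) (tagged z))) ->
  fp i (fun x => enc_set (iter (n x) (f x) (b0 x))).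
Proof.
move=> Hb Hf; apply: (@fp_iter X (fun x => {set 'I_(m x)}) i (fun x A => enc_set A)) => //.
by have [g bg Hg] := bounded_enc_set Hm; exists g.
Qed.

End SetPrograms.

Ltac fp_atom := solve [eassumption | apply: fp_end1; eassumption
  | apply: fp_end2; eassumption | by move=> *; auto].

Section GraphPrograms.
Variables (X : Type) (i : X -> data) (I : X -> instance).
Hypothesis HI : fp i (fun x => enc_instance (I x)).

Lemma fp_component (J : forall x, {set edge (I x)}) (s : forall x, node (I x)) :
  fp i (fun x => enc_set (J x)) -> fp i (fun x => enc_unary (s x)) ->
  fp i (fun x => enc_set (component (J x) (s x))).
Proof.
move=> HJ Hs; have Hn := fp_nnodes HI; have Hm := fp_nedges HI.
apply: (@fp_iter_set X i (fun x => nedges (I x)) Hm (fun x => nnodes (I x)) Hn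
  (fun x => reach_step (J x)) (fun x => [set s x])); first exact: fp_set1.
fp_enter; apply: fp_set; first eassumption.
fp_enter; apply: fp_or; first by apply: fp_in; eassumption.
apply: fp_exists; first eassumption.
fp_enter; apply: fp_and; first by apply: fp_in; eassumption.
by apply: fp_or; apply: fp_and; (apply: fp_in || apply: fp_eq_ord); fp_atom.
Qed.

Hypothesis cost_ge0 : forall x e, (0 <= cost (I x) e)%R.

Lemma fp_relax (L : forall x, {ffun node (I x) -> {set edge (I x)}})
    (b : forall x, {set edge (I x)}) (e : forall x, edge (I x)) (u v w : forall x, node (I x)) :
  fp i (fun x => enc_labels (L x)) -> fp i (fun x => enc_set (b x)) ->
  fp i (fun x => enc_unary (e x)) -> fp i (fun x => enc_unary (u x)) ->
  fp i (fun x => enc_unary (v x)) -> fp i (fun x => enc_unary (w x)) ->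
  fp i (fun x => enc_set (relax (L x) (b x) (e x) (u x) (v x) (w x))).
Proof.
move=> HL Hb He Hu Hv Hw; have Hn := fp_nnodes HI; have Hm := fp_nedges HI.
have HLu : fp i (fun x => enc_set (e x |: L x (u x))).
  by apply: fp_setU => //; [exact: fp_set1 | exact: fp_app].
apply: fp_if_set => //; apply: fp_and; first exact: fp_eq_ord.
exact: fp_cost_leq.
Qed.

End GraphPrograms.

Lemma fp_labels X (i : X -> data) (I : X -> instance)
    (J : forall x, {set edge (I x)}) (s : forall x, node (I x)) :
  fp i (fun x => enc_instance (I x)) -> (forall x e, (0 <= cost (I x) e)%R) ->
  fp i (fun x => enc_set (J x)) -> fp i (fun x => enc_unary (s x)) ->
  fp i (fun x => enc_labels (labels (J x) (s x))).
Proof.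
move=> HI c0 HJ Hs; have Hn := fp_nnodes HI; have Hm := fp_nedges HI.
apply: (@fp_iter X (fun x => {ffun node (I x) -> {set edge (I x)}}) i
  (fun x L => enc_labels L) (fun x => @bf_step (I x)) (fun x => nedges (I x))
  (fun x => bf_init (J x) (s x))) => //; last first.
- by have [g bg Hg] := bounded_enc_labels Hn Hm; exists g.
- fp_enter; apply: fp_ffun; first eassumption.
  fp_enter; apply: fp_foldl_set; [eassumption | eassumption | |].
    by apply: fp_app; eassumption.
  fp_enter.
  by do 2![apply: fp_relax; try fp_atom].
- apply: fp_ffun => //; fp_enter; apply: fp_if_set; first by apply: fp_eq_ord; fp_atom.
    fp_atom.
  by apply: fp_setT; fp_atom.
Qed.

Section Greedy.
Variables (valid : instance -> Prop) (F : forall I : instance, {set {set node I}}).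
Variable cov : forall I : instance, {set edge I} -> {set node I} -> {set edge I}.
Hypothesis cost_ge0 : forall I, valid I -> forall e : edge I, (0 <= cost I e)%R.
Hypothesis membership : residual_membership_polytime valid F.
Hypothesis cov_polytime : exists p k, forall I (J : {set edge I}) (s : node I),
  valid I -> coverable (F I) J s ->
  computes_within p k (enc_seq [:: enc_instance I; enc_set J; enc_set (component J s)])
    (enc_set (cov J (component J s))).

Section GreedyPrograms.
Variables (X : Type) (i : X -> data) (I : X -> instance).
Hypothesis valid_I : forall x, valid (I x).
Hypothesis HI : fp i (fun x => enc_instance (I x)).

Lemma fp_residual (J : forall x, {set edge (I x)}) (A : forall x, {set node (I x)}) :
  fp i (fun x => enc_set (J x)) -> fp i (fun x => enc_set (A x)) ->
  fp i (fun x => enc_bool (A x \in residual (F (I x)) (J x))).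
Proof.
move=> HJ HA; have [p [k H]] := membership.
apply: (@fp_comp _ _ (fun x => enc_seq [:: enc_instance (I x); enc_set (J x); enc_set (A x)])).
  by do 3![apply: fp_pair => //]; exact: fp_leaf.
by exists p, k => x; exact: H.
Qed.

Lemma fp_core (J : forall x, {set edge (I x)}) (s : forall x, node (I x)) :
  fp i (fun x => enc_set (J x)) -> fp i (fun x => enc_unary (s x)) ->
  fp i (fun x => enc_bool (core (F (I x)) (J x) (s x))).
Proof.
move=> HJ Hs; apply: fp_and; first by apply: fp_residual => //; exact: fp_component.
apply/fp_neg/fp_residual => //; apply: fp_set0; exact: fp_nnodes.
Qed.

End GreedyPrograms.

Section Candidates.
Variables (X : Type) (i : X -> data) (I : X -> instance).
Hypothesis valid_I : forall x, valid (I x).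
Hypothesis HI : fp i (fun x => enc_instance (I x)).
Variable J : forall x, {set edge (I x)}.
Hypothesis HJ : fp i (fun x => enc_set (J x)).

Lemma fp_coverable (s : forall x, node (I x)) :
  fp i (fun x => enc_unary (s x)) ->
  fp i (fun x => enc_bool (coverable (F (I x)) (J x) (s x))).
Proof.
move=> Hs; have Hn := fp_nnodes HI; have Hm := fp_nedges HI.
apply: fp_and; first exact: fp_core.
apply/fp_neg/fp_core => //; apply: fp_setU => //.
apply: fp_set => //; fp_enter.
apply: fp_and; apply: fp_or;
  (apply: fp_in || (apply/fp_neg/fp_core)); try fp_atom; apply: fp_component; fp_atom.
Qed.

Lemma fp_good (K : forall x, {set edge (I x)}) :
  fp i (fun x => enc_set (K x)) ->
  fp i (fun x => enc_bool (good (F (I x)) (J x) (K x))).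
Proof.
move=> HK; have Hn := fp_nnodes HI; have Hm := fp_nedges HI.
apply: fp_exists => //; fp_enter.
apply: fp_and; first by apply: fp_core; fp_atom.
apply: fp_or; first by apply/fp_neg/fp_core; fp_atom.
apply: fp_exists; first eassumption.
fp_enter; apply: fp_and; first by apply: fp_core; fp_atom.
by apply: fp_and; [|apply: fp_neg]; apply: fp_in; try fp_atom; apply: fp_component; fp_atom.
Qed.

Lemma fp_better (b K : forall x, {set edge (I x)}) :
  fp i (fun x => enc_set (b x)) -> fp i (fun x => enc_set (K x)) ->
  fp i (fun x => enc_set (better (F (I x)) (J x) (b x) (K x))).
Proof.
move=> Hb HK; have Hm := fp_nedges HI; apply: fp_if_set => //.
apply: fp_and; first exact: fp_good.
by apply: fp_cost_leq => // x e; exact: cost_ge0.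
Qed.

End Candidates.

Lemma fp_scan X (i : X -> data) (I : X -> instance) (J b : forall x, {set edge (I x)}) (s : forall x, node (I x)) :
  (forall x, valid (I x)) -> fp i (fun x => enc_instance (I x)) ->
  fp i (fun x => enc_set (J x)) -> fp i (fun x => enc_set (b x)) ->
  fp i (fun x => enc_unary (s x)) ->
  fp i (fun x => enc_set (scan (F (I x)) (@cov (I x)) (J x) (b x) (s x))).
Proof.
move=> valid_I HI HJ Hb Hs; have Hn := fp_nnodes HI; have Hm := fp_nedges HI.
have HL : fp i (fun x => enc_labels (labels (J x) (s x))).
  by apply: fp_labels => // x e; exact: cost_ge0.
pose b' x := foldl (fun b v => better (F (I x)) (J x) b (labels (J x) (s x) v)) (b x)
  (enum (node (I x))).
have Hb' : fp i (fun x => enc_set (b' x)).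
  apply: fp_foldl_set => //; fp_enter.
  by apply: fp_better; try fp_atom; apply: fp_app; fp_atom.
have Hc := fp_coverable valid_I HI HJ Hs.
have H : fp i (fun x => if coverable (F (I x)) (J x) (s x) then enc_set
    (better (F (I x)) (J x) (b' x) (J x :|: cov (J x) (component (J x) (s x))))
  else enc_set (b' x)).
  (* The running time of the program for restricted covers is known only for coverable cores, so
     this branch is analysed over the contexts that satisfy the guard. *)
  apply: (fp_if_dep Hc _ Hb').
  have lift f := @fp_reindex _ {x | coverable (F (I x)) (J x) (s x)} sval i f.
  have := lift _ HI; have := lift _ HJ; have := lift _ Hs; have := lift _ Hb'; have := lift _ Hm.
  move=> /= Wm Wb Ws WJ WI.
  apply: fp_better => //; apply: fp_setU => //.
  have [p [k H]] := cov_polytime.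
  apply: (@fp_comp _ _ (fun z => enc_seq [:: enc_instance (I (sval z)); enc_set (J (sval z));
    enc_set (component (J (sval z)) (s (sval z)))])).
    do 2![apply: fp_pair => //]; apply: fp_pair; last exact: fp_leaf.
    exact: fp_component.
  by exists p, k => -[x cx]; exact: H.
by apply: fp_eq H _ => x; rewrite /scan; case: ifP.
Qed.

Lemma fp_augment X (i : X -> data) (I : X -> instance) (J : forall x, {set edge (I x)}) :
  (forall x, valid (I x)) -> fp i (fun x => enc_instance (I x)) ->
  fp i (fun x => enc_set (J x)) ->
  fp i (fun x => enc_set (augment (F (I x)) (@cov (I x)) (J x))).
Proof.
move=> valid_I HI HJ; have Hn := fp_nnodes HI; have Hm := fp_nedges HI.
apply: fp_if_set => //.
  by apply: fp_exists => //; fp_enter; apply: fp_core; fp_atom.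
apply: fp_foldl_set => //; first exact: fp_setT.
by fp_enter; apply: fp_scan; fp_atom.
Qed.

Lemma fp_greedy X (i : X -> data) (I : X -> instance) :
  (forall x, valid (I x)) -> fp i (fun x => enc_instance (I x)) ->
  fp i (fun x => enc_set (greedy (F (I x)) (@cov (I x)))).
Proof.
move=> valid_I HI; have Hn := fp_nnodes HI; have Hm := fp_nedges HI.
apply: fp_foldl_set => //.
  apply: fp_iter_set => //; first exact: fp_set0.
  by fp_enter; apply: fp_augment; fp_atom.
fp_enter; apply: fp_if_set; [|by apply: fp_setD1; fp_atom|eassumption].
apply: fp_and; first by apply: fp_in; fp_atom.
apply: fp_in; first by fp_atom.
by apply: fp_component; try fp_atom; apply: fp_setD1; fp_atom.
Qed.

End Greedy.

Local Open Scope ring_scope.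

(** Feasibility is not assumed, because calls have to be safe on infeasible instances as well;
    [set0 \notin F] comes from [core]. *)
Lemma component_restricted (I : instance) (F : {set {set node I}}) J s :
  disjointness_compliable F -> coverable F J s ->
  component J s \in cores (residual F J) /\
  exists K, restricted_cover (residual F J) (component J s) K.
Proof.
move=> compF /andP[cs ncs]; have F0 : set0 \notin F.
  by move: cs; rewrite /core set0_residual => /andP[].
split; first exact: core_cores.
by exists (avoid F J s); exact: restricted_avoid.
Qed.

(** Assumption 2 provides a cover separately for each core. Classical choice turns these covers into
    a function from which the algorithm can be defined, with value [set0] where no set meets the
    specification. *)
Lemma restricted_cover_choice (R : realType) (valid : instance -> Prop)
    (F : forall I : instance, {set {set node I}}) (alpha : R) :
  (forall I, valid I -> disjointness_compliable (F I)) ->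
  restricted_cover_polytime valid F alpha ->
  exists cov : forall I, {set edge I} -> {set node I} -> {set edge I},
  exists p k, forall I (J : {set edge I}) (s : node I),
    valid I -> coverable (F I) J s ->
    computes_within p k (enc_seq [:: enc_instance I; enc_set J; enc_set (component J s)])
      (enc_set (cov I J (component J s))) /\
    approximate (restricted_cover (residual (F I) J) (component J s)) alpha
      (cov I J (component J s)).
Proof.
move=> compF [p [k H]].
pose spec I (J : {set edge I}) (C : {set node I}) (K : {set edge I}) :=
  computes_within p k (enc_seq [:: enc_instance I; enc_set J; enc_set C]) (enc_set K) /\
  approximate (restricted_cover (residual (F I) J) C) alpha K.
exists (fun I J C => if pselect (exists K, spec I J C K) is left e then projT1 (cid e) else set0).
exists p, k => I J s vI cov.
have [cC exK] := component_restricted (compF I vI) cov.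
have [K runK appK] := H I vI J _ cC exK.
case: pselect => [e|[]]; last by exists K.
exact: (projT2 (cid e)).
Qed.

Unset Implicit Arguments.

Theorem theorem4 (R : realType) (alpha : R) (valid : instance -> Prop)
    (F : forall I : instance, {set {set node I}})
    (alpha_ge1 : 1 <= alpha)
    (cost_ge0 : forall I : instance, valid I ->
       forall e : edge I, 0 <= cost I e)
    (F_compliable : forall I : instance, valid I ->
       disjointness_compliable (F I))
    (assumption1 : residual_membership_polytime valid F)
    (assumption2 : restricted_cover_polytime valid F alpha) :
  polytime_approximation valid F
    (fun I : instance =>
       alpha + Num.max alpha 2%:R * ln (#|cores (F I)|%:R : R)).
Proof.
have [cov [p [k covP]]] := restricted_cover_choice F_compliable assumption2.
have cov_polytime : exists p k, forall I (J : {set edge I}) (s : node I),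
    valid I -> coverable (F I) J s ->
    computes_within p k (enc_seq [:: enc_instance I; enc_set J; enc_set (component J s)])
      (enc_set (cov I J (component J s))).
  by exists p, k => I J s vI c; case: (covP I J s vI c).
(* The context is a valid instance together with the proof that it is valid, so one program and one
   bound serve the whole class. *)
have [q [l Hq]] := fp_greedy (I := fun x : {I | valid I} => sval x) cost_ge0 assumption1
  cov_polytime (fun x => svalP x) (fp_id _).
exists q, l => I vI; exists (enc_set (greedy (F I) (cov I))).
  exact: (Hq (exist _ I vI)).
move=> feas; exists (greedy (F I) (cov I)) => //.
apply: greedy_approximate => //; [exact: cost_ge0 | exact: F_compliable |].
by move=> J s c; case: (covP I J s vI c).
Qed.
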